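(* Let $f\in\mathcal{A}$, let $\alpha>1$ be real, and suppose that $$\left|\arg\left[\alpha+\frac{zf''(z)}{f'(z)}\right]\right|<\arctan\frac{\sqrt{3}}{\alpha-1}\qquad\text{for all } z\in\mathbb{D}.$$ Then $f\in\mathcal{S}^{\star}$.
   Context: $\mathbb{D}=\{z\in\mathbb{C}:|z|<1\}$ is the open unit disc. $\mathcal{A}$ is the class of functions $f$ analytic in $\mathbb{D}$ of the form $f(z)=z+a_2z^2+a_3z^3+\cdots$ (i.e. $f(0)=0$, $f'(0)=1$). The class of starlike functions is $\mathcal{S}^{\star}=\left\{f\in\mathcal{A}:\operatorname{Re}\left[\frac{zf'(z)}{f(z)}\right]>0 \text{ for all } z\in\mathbb{D}\right\}$, where $\frac{zf'(z)}{f(z)}$ takes the value $1$ at $z=0$ (removable singularity). $\arg$ denotes the principal argument. *)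

(* Defs.v *)
From Stdlib Require Import Reals Lra.
From Coquelicot Require Import Coquelicot.
Open Scope R_scope.

Definition unit_disc (z : C) : Prop := Cmod z < 1.

Definition analytic_at (f : C -> C) (z0 : C) : Prop :=
  exists (a : nat -> C) (r : R), 0 < r /\
    forall z : C, Cmod (z - z0) < r ->
      @is_pseries C_AbsRing C_NormedModule a (z - z0)%C (f z).

(* A function on the disc is represented by a total function on C whose values
   outside the disc are irrelevant. *)
Definition class_A (f : C -> C) : Prop :=
  (forall z : C, unit_disc z -> analytic_at f z) /\
  f (RtoC 0) = RtoC 0 /\ C_derive f (RtoC 0) = RtoC 1.

(* z f'(z) / f(z), with its removable singularity at 0 filled in. *)
Definition starlike_quotient (f : C -> C) (z : C) : C :=
  if Ceq_dec z (RtoC 0) then RtoC 1 else (z * C_derive f z / f z)%C.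

(* The nonvanishing clause says that the quotient is defined; Cdiv is total. *)
Definition starlike (f : C -> C) : Prop :=
  class_A f /\
  forall z : C, unit_disc z ->
    (z <> RtoC 0 -> f z <> RtoC 0) /\ 0 < Re (starlike_quotient f z).

(* Principal argument, with values in (-PI, PI]; see Carg_spec.  The argument
   of 0 is undefined: since x / 0 = 0 the formula returns PI / 2 there, so a
   bound |Carg w| < b with b <= PI / 2 forces w <> 0. *)
Definition Carg (w : C) : R :=
  if Rlt_dec (Im w) 0 then - acos (Re w / Cmod w) else acos (Re w / Cmod w).

Lemma Carg_spec (w : C) : w <> RtoC 0 ->
  - PI < Carg w <= PI /\
  w = (Cmod w * cos (Carg w), Cmod w * sin (Carg w)).
Proof.
intros Hw.
assert (Hm : 0 < Cmod w) by (now apply Cmod_gt_0).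
destruct w as [x y]; unfold Carg; simpl Re; simpl Im.
set (m := Cmod (x, y)) in *.
assert (Hm2 : m * m = x * x + y * y).
{ unfold m, Cmod; simpl fst; simpl snd; rewrite sqrt_sqrt; nra. }
set (c := x / m).
assert (Hx : x = m * c) by (unfold c; field; lra).
clearbody c.
assert (Hxx : x * x = m * m * (c * c)) by (rewrite Hx; ring).
assert (Hc2 : (m * m) * (1 - c * c) = y * y) by lra.
assert (Hc1 : c * c <= 1).
{ apply Rmult_le_reg_l with (m * m); [nra|].
  pose proof (Rle_0_sqr y) as Hy2; unfold Rsqr in Hy2; lra. }
assert (Hc : -1 <= c <= 1) by nra.
assert (Hs : m * sqrt (1 - c²) = Rabs y).
{ rewrite <- (sqrt_Rsqr m) at 1 by lra.
  rewrite <- sqrt_mult_alt by (unfold Rsqr; nra).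
  unfold Rsqr; rewrite Hc2; apply sqrt_Rsqr_abs. }
pose proof (acos_bound c) as Hb.
destruct (Rlt_dec y 0) as [Hy|Hy].
- assert (acos c <> PI).
  { intros E; assert (Ec := cos_acos c Hc); rewrite E, cos_PI in Ec.
    rewrite <- Ec in Hc2; nra. }
  split; [lra|].
  rewrite cos_neg, sin_neg, cos_acos, sin_acos by lra.
  rewrite Rabs_left in Hs by lra.
  f_equal; lra.
- assert (0 < PI) by apply PI_RGT_0.
  split; [lra|].
  rewrite cos_acos, sin_acos by lra.
  rewrite Rabs_pos_eq in Hs by lra.
  f_equal; lra.
Qed.

(* Main.v *)
Require Import Defs.
From Stdlib Require Import Reals Lra Lia Psatz Classical ClassicalEpsilon.
From Coquelicot Require Import Coquelicot.
Open Scope R_scope.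

(** Put g = z f' and P = 1 + z f''/f'. The argument condition gives
    Re (z f''/f') > - alpha, so t^n |f'(t z)|^2 is nondecreasing in t for
    n >= 2 alpha, and f' has no zero in the disc. Starlikeness at z <> 0 means
    Re (g / f) > 0, that is |g - f| < |g + f|. If this fails, let z0 be a point
    of least modulus rho where it fails. Then f/g = i b at z0 with b real.
    Schwarz's lemma for (g - f)/(g + f) on |z| <= rho, together with the
    first-order conditions at z0, gives b Re P = 0 and b Im P <= -(3 + b^2)/2.
    Hence P is purely imaginary with |P| >= sqrt 3 at z0, so alpha - 1 + P lies
    outside the sector |arg| < arctan (sqrt 3 / (alpha - 1)). *)

(** * Complex power series *)

(** At a zero of [f] the moduli |g - f| and |g + f| agree, so such a zero counts as a failure and
    shows up as the case b = 0. Ruling out b = 0 therefore also proves that [f] has no zero other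
    than 0. This is why f/g is used at z0 rather than g/f: the nonvanishing of f' keeps g away from
    0 at z0. The inequality inside the circle alone would give only b Im P <= -1, hence |P| >=
    1/|b|, which is no bound independent of b. Schwarz's lemma makes the quotient shrink at least
    linearly along the radius, which lowers the bound on b Im P by a further (1 + b^2)/2; the
    minimum of (3 + b^2)/(2|b|) is sqrt 3, attained at |b| = sqrt 3. Analyticity is given as a local
    power series at each point, and no single expansion is known to cover the disc. So zeros,
    derivatives and the maximum principle are obtained from local expansions, which compactness then
    joins. *)

Notation C_series := (@is_series C_AbsRing C_NormedModule).

(** The bound is multiplied out and not strict, so the increment [h = 0] needs no exclusion and
    nothing is divided. *)
Definition C_diff (f : C -> C) (z l : C) : Prop :=
  forall eps : R, 0 < eps -> exists delta : R, 0 < delta /\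
    forall h : C, Cmod h < delta ->
      Cmod (f (z + h) - f z - l * h)%C <= eps * Cmod h.

Lemma pow_n_Cpow (z : C) (n : nat) : @pow_n C_AbsRing z n = (z ^ n)%C.
Proof.
induction n as [|n IH]; [reflexivity|].
change (@pow_n C_AbsRing z (S n)) with (z * @pow_n C_AbsRing z n)%C.
rewrite IH; reflexivity.
Qed.

Lemma C_pseries_series (a : nat -> C) (x l : C) :
  @is_pseries C_AbsRing C_NormedModule a x l <->
  C_series (fun n => a n * x ^ n)%C l.
Proof.
unfold is_pseries; split; apply is_series_ext; intros n;
  change scal with Cmult; (replace (@pow_n C_AbsRing x n) with (x ^ n)%C
    by (symmetry; apply pow_n_Cpow)); apply Cmult_comm.
Qed.

Lemma C_series_norm_le (a : nat -> C) (b : nat -> R) (l : C) (lb : R) :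
  C_series a l -> is_series b lb -> (forall n, Cmod (a n) <= b n) -> Cmod l <= lb.
Proof.
intros Ha Hb Hle.
assert (H1 : filterlim (fun n => @norm C_AbsRing C_NormedModule (sum_n a n)) eventually
               (locally (@norm C_AbsRing C_NormedModule l))).
{ eapply filterlim_comp; [exact Ha|apply filterlim_norm]. }
change (Rbar_le (@norm C_AbsRing C_NormedModule l) lb).
apply (is_lim_seq_le (fun n => @norm C_AbsRing C_NormedModule (sum_n a n)) (sum_n b)
         (@norm C_AbsRing C_NormedModule l) lb); [|exact H1|exact Hb].
intros n; unfold sum_n.
eapply Rle_trans; [apply (norm_sum_n_m (K := C_AbsRing) (V := C_NormedModule))|].
apply sum_n_m_le; intros k; apply Hle.
Qed.

Lemma C_series_bounded (a : nat -> C) (l : C) :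
  C_series a l -> exists M : R, 0 < M /\ forall n, Cmod (a n) <= M.
Proof.
intros Ha.
destruct (filterlim_bounded (K := C_AbsRing) (V := C_NormedModule) (sum_n a)) as [M HM].
{ exists l; exact Ha. }
assert (HM' : forall n, Cmod (sum_n a n) <= M) by apply HM.
exists (2 * M + 1); split.
{ pose proof (HM' O); pose proof (Cmod_ge_0 (sum_n a O)); lra. }
intros [|n].
- pose proof (HM' O) as H; rewrite sum_O in H; pose proof (Cmod_ge_0 (a O)); lra.
- replace (a (S n)) with (sum_n a (S n) + - sum_n a n)%C.
  + eapply Rle_trans; [apply Cmod_triangle|]; rewrite Cmod_opp.
    pose proof (HM' n); pose proof (HM' (S n)); lra.
  + rewrite sum_Sn; change plus with Cplus; ring.
Qed.

(** This is the second derivative of the geometric series, whose radius of convergence is at least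
    1. *)
Lemma ex_series_quadratic_geom (q : R) : 0 <= q < 1 ->
  ex_series (fun n => INR (S n) * INR (S (S n)) * q ^ n).
Proof.
intros Hq.
assert (H : ex_pseries (PS_derive (PS_derive (fun _ => 1))) q).
{ apply CV_radius_inside; rewrite !CV_radius_derive.
  apply Rbar_lt_le_trans with 1; [simpl; rewrite Rabs_pos_eq; lra|].
  apply (proj1 (CV_radius_bounded (fun _ => 1))).
  exists 1; intros n; rewrite pow1, Rmult_1_r, Rabs_R1; lra. }
destruct H as [l Hl]; exists l; apply is_pseries_R in Hl.
revert Hl; apply is_series_ext; intros n; unfold PS_derive.
match goal with |- @eq _ ?x ?y => change (@eq R x y) end; ring.
Qed.

(** The remainder T_n satisfies T_(n+1) = z T_n + n w^(n-1) (z - w)^2, and n^2 + n <= (n + 1)^2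
    closes the induction. The bound is uniform in [z] and [w], and its dependence on [n] is summable
    against the coefficients. *)
Lemma Cpow_taylor_le (z w : C) (rho : R) (n : nat) :
  0 < rho -> Cmod z <= rho -> Cmod w <= rho ->
  Cmod (z ^ n - w ^ n - INR n * w ^ pred n * (z - w))%C
    <= INR n * INR n * rho ^ n / (rho * rho) * (Cmod (z - w) * Cmod (z - w)).
Proof.
intros Hr Hz Hw; set (d := Cmod (z - w)).
assert (Hd : 0 <= d) by apply Cmod_ge_0.
induction n as [|n IH].
{ replace (z ^ 0 - w ^ 0 - INR 0 * w ^ pred 0 * (z - w))%C with (RtoC 0)
    by (simpl; ring).
  rewrite Cmod_0; simpl INR; unfold Rdiv; rewrite !Rmult_0_l; lra. }
replace (z ^ S n - w ^ S n - INR (S n) * w ^ pred (S n) * (z - w))%C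
  with (z * (z ^ n - w ^ n - INR n * w ^ pred n * (z - w))
        + INR n * w ^ pred n * ((z - w) * (z - w)))%C.
2:{ rewrite S_INR, RtoC_plus; simpl pred; rewrite !Cpow_S.
    destruct n as [|n]; [simpl; ring|].
    simpl pred; rewrite !Cpow_S; ring. }
eapply Rle_trans; [apply Cmod_triangle|].
rewrite !Cmod_mult, Cmod_pow, Cmod_R, (Rabs_pos_eq (INR n)) by apply pos_INR.
fold d.
assert (H1 : INR n * Cmod w ^ pred n <= INR n * rho ^ n / rho).
{ destruct n as [|n]; [simpl INR; unfold Rdiv; rewrite !Rmult_0_l; lra|].
  simpl pred.
  replace (INR (S n) * rho ^ S n / rho) with (INR (S n) * rho ^ n) by (simpl pow; field; lra).
  apply Rmult_le_compat_l; [apply pos_INR|].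
  apply pow_incr; split; [apply Cmod_ge_0|exact Hw]. }
assert (Hp : 0 <= rho ^ n) by (apply pow_le; lra).
pose proof (pos_INR n) as Hn.
apply Rle_trans with
  (rho * (INR n * INR n * rho ^ n / (rho * rho) * (d * d)) + INR n * rho ^ n / rho * (d * d)).
- apply Rplus_le_compat.
  + apply Rmult_le_compat; [apply Cmod_ge_0|apply Cmod_ge_0|exact Hz|exact IH].
  + apply Rmult_le_compat_r; [nra|exact H1].
- rewrite S_INR; simpl pow.
  replace (rho * (INR n * INR n * rho ^ n / (rho * rho) * (d * d)) + INR n * rho ^ n / rho * (d * d))
    with ((INR n * INR n + INR n) * (rho ^ n / rho * (d * d))) by (field; lra).
  replace ((INR n + 1) * (INR n + 1) * (rho * rho ^ n) / (rho * rho) * (d * d))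
    with ((INR n + 1) * (INR n + 1) * (rho ^ n / rho * (d * d))) by (field; lra).
  apply Rmult_le_compat_r; [|nra].
  apply Rmult_le_pos; [apply Rdiv_le_0_compat; lra|nra].
Qed.

(** Convergence at a radius [s] strictly between [rho] and [r] bounds |a_n| s^n, so |a_n| rho^n is
    at most a constant times the geometric sequence of ratio [rho / s]. The quadratic factors are
    absorbed by [ex_series_quadratic_geom]. *)
Lemma C_series_majorant (a : nat -> C) (F : C -> C) (r rho : R) :
  0 < rho < r ->
  (forall x, Cmod x < r -> C_series (fun n => a n * x ^ n)%C (F x)) ->
    ex_series (fun n => Cmod (a n) * (INR n * INR n * rho ^ n)) /\
    ex_series (fun n => INR (S n) * Cmod (a (S n)) * rho ^ n).
Proof.
intros Hr HF.
set (s := (rho + r) / 2).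
assert (Hs : rho < s < r) by (unfold s; lra).
destruct (C_series_bounded (fun n => a n * (RtoC s) ^ n)%C (F s)) as [M [HM HMn]].
{ apply HF; rewrite Cmod_R, Rabs_pos_eq; lra. }
set (q := rho / s).
assert (Hq : 0 < q < 1).
{ unfold q; split; [apply Rdiv_lt_0_compat; lra|].
  apply Rlt_div_l; lra. }
assert (Hb : forall n, Cmod (a n) * rho ^ n <= M * q ^ n).
{ intros n; specialize (HMn n).
  rewrite Cmod_mult, Cmod_pow, Cmod_R, Rabs_pos_eq in HMn by lra.
  replace (rho ^ n) with (s ^ n * q ^ n).
  2:{ rewrite <- Rpow_mult_distr; f_equal; unfold q; field; lra. }
  rewrite <- Rmult_assoc; apply Rmult_le_compat_r; [apply pow_le; lra|exact HMn]. }
assert (Hex : forall c : R, ex_series (fun n => c * (INR (S n) * INR (S (S n)) * q ^ n))).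
{ intros c.
  apply (ex_series_scal c (fun n => INR (S n) * INR (S (S n)) * q ^ n)).
  apply ex_series_quadratic_geom; lra. }
split.
- apply (ex_series_le (K := R_AbsRing) (V := R_CompleteNormedModule)) with
    (fun n => M * (INR (S n) * INR (S (S n)) * q ^ n)); [|apply Hex].
  intros n; change norm with Rabs.
  pose proof (pos_INR n); pose proof (Cmod_ge_0 (a n)).
  assert (0 <= rho ^ n) by (apply pow_le; lra).
  assert (0 <= q ^ n) by (apply pow_le; lra).
  rewrite Rabs_pos_eq.
  2:{ apply Rmult_le_pos; [lra|]; apply Rmult_le_pos; [nra|lra]. }
  replace (Cmod (a n) * (INR n * INR n * rho ^ n))
    with (INR n * INR n * (Cmod (a n) * rho ^ n)) by ring.
  apply Rle_trans with (INR n * INR n * (M * q ^ n)).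
  { apply Rmult_le_compat_l; [nra|apply Hb]. }
  replace (M * (INR (S n) * INR (S (S n)) * q ^ n))
    with (INR (S n) * INR (S (S n)) * (M * q ^ n)) by ring.
  apply Rmult_le_compat_r; [nra|].
  rewrite !S_INR; nra.
- apply (ex_series_le (K := R_AbsRing) (V := R_CompleteNormedModule)) with
    (fun n => M * q / rho * (INR (S n) * INR (S (S n)) * q ^ n)); [|apply Hex].
  intros n; change norm with Rabs.
  pose proof (pos_INR n); pose proof (Cmod_ge_0 (a (S n))).
  assert (0 <= rho ^ n) by (apply pow_le; lra).
  assert (0 <= q ^ n) by (apply pow_le; lra).
  pose proof (pos_INR (S n)).
  rewrite Rabs_pos_eq.
  2:{ apply Rmult_le_pos; [apply Rmult_le_pos|]; lra. }
  specialize (Hb (S n)); simpl pow in Hb.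
  assert (Hb' : Cmod (a (S n)) * rho ^ n <= M * q / rho * q ^ n).
  { apply Rmult_le_reg_r with rho; [lra|].
    replace (M * q / rho * q ^ n * rho) with (M * (q * q ^ n)) by (field; lra).
    lra. }
  assert (0 <= Cmod (a (S n)) * rho ^ n) by nra.
  rewrite Rmult_assoc.
  replace (M * q / rho * (INR (S n) * INR (S (S n)) * q ^ n))
    with (INR (S n) * (INR (S (S n)) * (M * q / rho * q ^ n))) by ring.
  apply Rmult_le_compat_l; [lra|].
  rewrite (S_INR (S n)).
  assert (Hpos : 0 <= M * q / rho * q ^ n) by lra.
  nra.
Qed.

(** Summing the remainders of the powers gives an error at most K |z - w|^2 on a disc of radius
    [rho] around 0 that contains [w], which is more than differentiability requires. *)
Lemma C_series_derive (a : nat -> C) (F : C -> C) (r : R) :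
  (forall x, Cmod x < r -> C_series (fun n => a n * x ^ n)%C (F x)) ->
  exists G : C -> C,
    (forall x, Cmod x < r -> C_series (fun n => (INR (S n) * a (S n)) * x ^ n)%C (G x)) /\
    (forall x, Cmod x < r -> C_diff F x (G x)).
Proof.
intros HF.
assert (HG : forall x, exists y : C, Cmod x < r ->
    C_series (fun n => (INR (S n) * a (S n)) * x ^ n)%C y).
{ intros x; destruct (Rlt_dec (Cmod x) r) as [Hx|Hx]; [|exists (RtoC 0); lra].
  pose proof (Cmod_ge_0 x).
  set (rho := (Cmod x + r) / 2).
  destruct (C_series_majorant a F r rho) as [_ H2]; [unfold rho; lra|exact HF|].
  destruct (ex_series_le (K := C_AbsRing) (V := C_CompleteNormedModule)
    (fun n => (INR (S n) * a (S n)) * x ^ n)%C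
    (fun n => INR (S n) * Cmod (a (S n)) * rho ^ n)) as [y Hy]; [|exact H2|].
  - intros n; change norm with Cmod.
    rewrite !Cmod_mult, Cmod_pow, Cmod_R, Rabs_pos_eq by apply pos_INR.
    apply Rmult_le_compat_l.
    + apply Rmult_le_pos; [apply pos_INR|apply Cmod_ge_0].
    + apply pow_incr; unfold rho; lra.
  - exists y; intros _; exact Hy. }
destruct (choice _ HG) as [G HG'].
exists G; split; [exact HG'|].
intros w Hw eps Heps.
pose proof (Cmod_ge_0 w).
set (rho := (Cmod w + r) / 2).
assert (Hrho : 0 < rho < r /\ Cmod w < rho) by (unfold rho; lra).
destruct (C_series_majorant a F r rho) as [[B HB] _]; [lra|exact HF|].
set (K := B / (rho * rho)).
assert (Hkey : forall z, Cmod z < rho ->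
  Cmod (F z - F w - G w * (z - w))%C <= K * (Cmod (z - w) * Cmod (z - w))).
{ intros z Hz.
  assert (S1 : C_series (fun n => a n * (z ^ n - w ^ n - INR n * w ^ pred n * (z - w)))%C
            (F z - F w - G w * (z - w))%C).
  (* The term of index 0 vanishes, so the derived series can be indexed by the powers of [F] itself
     and subtracted term by term. *)
  { assert (Sd : C_series (fun n => INR n * a n * w ^ pred n)%C (G w)).
    { apply (is_series_decr_1 (K := C_AbsRing) (V := C_NormedModule)
               (fun n => INR n * a n * w ^ pred n)%C (G w)).
      match goal with |- is_series _ ?x => replace x with (G w) end.
      - apply HG'; lra.
      - change (G w = G w + - (RtoC 0 * a O * w ^ 0))%C; ring. }
    apply (is_series_scal (K := C_AbsRing) (V := C_NormedModule) (z - w)%C) in Sd.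
    pose proof (is_series_minus _ _ _ _ (is_series_minus _ _ _ _ (HF z ltac:(lra)) (HF w Hw)) Sd) as S.
    replace (F z - F w - G w * (z - w))%C
      with (plus (plus (F z) (opp (F w))) (opp (scal (z - w)%C (G w)))).
    - revert S; apply is_series_ext; intros n.
      change (a n * z ^ n + - (a n * w ^ n) + - ((z - w) * (INR n * a n * w ^ pred n))
        = a n * (z ^ n - w ^ n - INR n * w ^ pred n * (z - w)))%C; ring.
    - change (F z + - F w + - ((z - w) * G w) = F z - F w - G w * (z - w))%C; ring. }
  pose proof (is_series_scal (K := R_AbsRing) (V := R_NormedModule)
    (/ (rho * rho) * (Cmod (z - w) * Cmod (z - w))) _ _ HB) as S2.
  eapply Rle_trans; [apply (C_series_norm_le _ _ _ _ S1 S2)|].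
  - intros n; change scal with Rmult.
    rewrite Cmod_mult.
    replace (/ (rho * rho) * (Cmod (z - w) * Cmod (z - w)) *
      (Cmod (a n) * (INR n * INR n * rho ^ n)))
      with (Cmod (a n) * (INR n * INR n * rho ^ n / (rho * rho) * (Cmod (z - w) * Cmod (z - w))))
      by (field; lra).
    apply Rmult_le_compat_l; [apply Cmod_ge_0|].
    apply Cpow_taylor_le; lra.
  - change scal with Rmult; unfold K; right; field; lra. }
(* The first bound keeps [w + h] inside radius [rho]; the second makes K |h|^2 <= eps |h|, with
   [Rabs K + 1] as a denominator that is surely positive. *)
set (delta := Rmin (rho - Cmod w) (eps / (Rabs K + 1))).
assert (HK : 0 < eps / (Rabs K + 1)) by (apply Rdiv_lt_0_compat; pose proof (Rabs_pos K); lra).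
exists delta; split; [apply Rmin_pos; lra|].
intros h Hh.
pose proof (Rmin_l (rho - Cmod w) (eps / (Rabs K + 1))).
pose proof (Rmin_r (rho - Cmod w) (eps / (Rabs K + 1))).
fold delta in H0, H1.
pose proof (Cmod_triangle w h).
specialize (Hkey (w + h)%C ltac:(lra)).
replace (w + h - w)%C with h in Hkey by ring.
eapply Rle_trans; [exact Hkey|].
pose proof (Cmod_ge_0 h); pose proof (Rle_abs K); pose proof (Rabs_pos K).
assert (Cmod h * (Rabs K + 1) <= eps).
{ replace eps with (eps / (Rabs K + 1) * (Rabs K + 1)) by (field; lra).
  apply Rmult_le_compat_r; lra. }
nra.
Qed.

(** * Analytic functions *)

Lemma C_diff_unique (f : C -> C) (z l : C) : C_diff f z l -> C_derive f z = l.
Proof.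
intros Hf; apply is_C_derive_unique; split.
- apply is_linear_scal_l.
- intros x Hx eps.
  apply (is_filter_lim_locally_unique (K := C_AbsRing)
           (V := AbsRing_NormedModule C_AbsRing) z x) in Hx; subst x.
  destruct (Hf eps (cond_pos eps)) as [d [Hd H]].
  exists (mkposreal d Hd); intros y Hy; change C in y.
  change (Cmod (y - z)%C < d) in Hy.
  specialize (H (y - z)%C Hy).
  change (Cmod (f y - f z - (y - z) * l)%C <= eps * Cmod (y - z)%C).
  replace (z + (y - z))%C with y in H by ring.
  rewrite (Cmult_comm (y - z) l); exact H.
Qed.

Lemma C_diff_ext_loc (f g : C -> C) (z l : C) (d : R) :
  0 < d -> (forall h, Cmod h < d -> f (z + h)%C = g (z + h)%C) ->
  C_diff f z l -> C_diff g z l.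
Proof.
intros Hd Hfg Hf eps Heps.
destruct (Hf eps Heps) as [e [He H]].
exists (Rmin d e); split; [apply Rmin_pos; assumption|].
intros h Hh; pose proof (Rmin_l d e); pose proof (Rmin_r d e).
assert (E : f z = g z).
{ replace z with (z + 0)%C by ring; apply Hfg; rewrite Cmod_0; exact Hd. }
rewrite <- Hfg, <- E by lra; apply H; lra.
Qed.

Lemma C_diff_shift (f : C -> C) (z w l : C) :
  C_diff (fun h => f (z + h)%C) w l -> C_diff f (z + w)%C l.
Proof.
intros Hf eps Heps; destruct (Hf eps Heps) as [d [Hd H]].
exists d; split; [exact Hd|]; intros h Hh.
rewrite <- Cplus_assoc; apply H; exact Hh.
Qed.

Lemma C_diff_cont (f : C -> C) (z l : C) : C_diff f z l ->
  forall eps, 0 < eps -> exists delta, 0 < delta /\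
    forall h, Cmod h < delta -> Cmod (f (z + h) - f z)%C < eps.
Proof.
intros Hf eps Heps; destruct (Hf 1 Rlt_0_1) as [d [Hd H]].
pose proof (Cmod_ge_0 l) as Hl.
assert (He : 0 < eps / (Cmod l + 1)) by (apply Rdiv_lt_0_compat; lra).
exists (Rmin d (eps / (Cmod l + 1))); split; [apply Rmin_pos; lra|].
intros h Hh; pose proof (Rmin_l d (eps / (Cmod l + 1)));
  pose proof (Rmin_r d (eps / (Cmod l + 1))).
specialize (H h ltac:(lra)).
replace (f (z + h) - f z)%C with ((f (z + h) - f z - l * h) + l * h)%C by ring.
eapply Rle_lt_trans; [apply Cmod_triangle|]; rewrite Cmod_mult.
assert (Cmod h * (Cmod l + 1) < eps).
{ replace eps with (eps / (Cmod l + 1) * (Cmod l + 1)) by (field; lra).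
  apply Rmult_lt_compat_r; lra. }
lra.
Qed.

Lemma C_diff_id_mult (f : C -> C) (z l : C) :
  C_diff f z l -> C_diff (fun w => w * f w)%C z (f z + z * l)%C.
Proof.
intros Hf eps Heps.
pose proof (Cmod_ge_0 z) as Hz.
assert (He : 0 < eps / (2 * (Cmod z + 1))) by (apply Rdiv_lt_0_compat; lra).
destruct (Hf _ He) as [d1 [Hd1 H1]].
destruct (C_diff_cont f z l Hf (eps / 2) ltac:(lra)) as [d2 [Hd2 H2]].
exists (Rmin d1 d2); split; [apply Rmin_pos; assumption|].
intros h Hh; pose proof (Rmin_l d1 d2); pose proof (Rmin_r d1 d2).
specialize (H1 h ltac:(lra)); specialize (H2 h ltac:(lra)).
replace ((z + h) * f (z + h) - z * f z - (f z + z * l) * h)%C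
  with (z * (f (z + h) - f z - l * h) + (f (z + h) - f z) * h)%C by ring.
eapply Rle_trans; [apply Cmod_triangle|]; rewrite !Cmod_mult.
pose proof (Cmod_ge_0 h).
assert (Cmod z * (eps / (2 * (Cmod z + 1))) <= eps / 2).
{ replace (eps / 2) with ((Cmod z + 1) * (eps / (2 * (Cmod z + 1)))) by (field; lra).
  apply Rmult_le_compat_r; lra. }
assert (Cmod z * Cmod (f (z + h) - f z - l * h)%C <= eps / 2 * Cmod h).
{ eapply Rle_trans; [apply Rmult_le_compat_l; [lra|exact H1]|].
  rewrite <- Rmult_assoc; apply Rmult_le_compat_r; lra. }
assert (Cmod (f (z + h) - f z)%C * Cmod h <= eps / 2 * Cmod h)
  by (apply Rmult_le_compat_r; lra).
lra.
Qed.

Lemma Rabs_Im_le_Cmod (z : C) : Rabs (Im z) <= Cmod z.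
Proof. eapply Rle_trans; [apply Rmax_r|apply Rmax_Cmod]. Qed.

(** Restriction to real lines hands complex questions over to real calculus: the mean value theorem
    and one-sided sign arguments then apply to real and imaginary parts. *)
Lemma C_diff_line (f : C -> C) (z v l : C) (s : R) :
  C_diff f (z + s * v)%C l ->
  is_derive (fun t : R => Re (f (z + t * v)%C)) s (Re (l * v)%C) /\
  is_derive (fun t : R => Im (f (z + t * v)%C)) s (Im (l * v)%C).
Proof.
intros Hf.
pose proof (Cmod_ge_0 v) as Hv.
assert (Hkey : forall eps, 0 < eps -> exists d : posreal, forall h, h <> 0 -> Rabs h < d ->
  Cmod ((f (z + (s + h)%R * v) - f (z + s * v)) / h - l * v)%C < eps).
{ intros eps Heps.
  assert (He : 0 < eps / (2 * (Cmod v + 1))) by (apply Rdiv_lt_0_compat; lra).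
  destruct (Hf _ He) as [d [Hd H]].
  assert (Hd' : 0 < d / (Cmod v + 1)) by (apply Rdiv_lt_0_compat; lra).
  exists (mkposreal _ Hd'); intros h Hh0 Hh; simpl in Hh.
  assert (Hh' : 0 < Rabs h) by (apply Rabs_pos_lt; exact Hh0).
  assert (HhC : RtoC h <> RtoC 0) by (intros E; apply Hh0; injection E; auto).
  assert (Hhv : Cmod (h * v)%C < d).
  { rewrite Cmod_mult, Cmod_R.
    replace d with (d / (Cmod v + 1) * (Cmod v + 1)) by (field; lra). nra. }
  specialize (H _ Hhv).
  replace (z + s * v + h * v)%C with (z + (s + h)%R * v)%C in H by (rewrite RtoC_plus; ring).
  set (D := (f (z + (s + h)%R * v) - f (z + s * v))%C) in *.
  replace (D / h - l * v)%C with ((D - l * (h * v)) / h)%C by (field; exact HhC).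
  rewrite Cmod_div, Cmod_R by exact HhC.
  apply Rlt_div_l; [exact Hh'|].
  eapply Rle_lt_trans; [exact H|]; rewrite Cmod_mult, Cmod_R.
  rewrite (Rmult_comm (Rabs h)), <- Rmult_assoc.
  apply Rmult_lt_compat_r; [exact Hh'|].
  replace eps with (eps / (2 * (Cmod v + 1)) * (2 * (Cmod v + 1))) at 2 by (field; lra).
  apply Rmult_lt_compat_l; lra. }
split; apply is_derive_Reals; intros eps Heps; destruct (Hkey eps Heps) as [d H];
  exists d; intros h Hh0 Hh; specialize (H h Hh0 Hh);
  (eapply Rle_lt_trans; [|exact H]).
- eapply Rle_trans; [|apply re_le_Cmod]; right; f_equal.
  destruct (f (z + (s + h)%R * v)%C), (f (z + s * v)%C), (l * v)%C.
  simpl; field; exact Hh0.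
- eapply Rle_trans; [|apply Rabs_Im_le_Cmod]; right; f_equal.
  destruct (f (z + (s + h)%R * v)%C), (f (z + s * v)%C), (l * v)%C.
  simpl; field; exact Hh0.
Qed.

Lemma analytic_at_series (f : C -> C) (z : C) :
  analytic_at f z <->
  exists (a : nat -> C) (r : R), 0 < r /\
    forall h, Cmod h < r -> C_series (fun n => a n * h ^ n)%C (f (z + h)%C).
Proof.
split; intros [a [r [Hr H]]]; exists a, r; (split; [exact Hr|]); intros h Hh.
- apply (C_pseries_series a h).
  specialize (H (z + h)%C); replace (z + h - z)%C with h in H by ring; apply H; exact Hh.
- apply (C_pseries_series a (h - z)).
  specialize (H (h - z)%C Hh); replace (z + (h - z))%C with h in H by ring; exact H.
Qed.

(** A single expansion at [z] is differentiable at every point of its disc, not only at the centre.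
    So it yields the derivative nearby, and the expansion of that derivative, without re-expanding
    about [z + h]. *)
Lemma analytic_at_derive_near (f : C -> C) (z : C) :
  analytic_at f z ->
  analytic_at (C_derive f) z /\
  exists d, 0 < d /\ forall h, Cmod h < d -> C_diff f (z + h)%C (C_derive f (z + h)%C).
Proof.
intros Hf; apply analytic_at_series in Hf; destruct Hf as [a [r [Hr H]]].
destruct (C_series_derive a (fun h => f (z + h)%C) r H) as [G [HG HD]].
assert (HE : forall h, Cmod h < r -> C_derive f (z + h)%C = G h).
{ intros h Hh; apply C_diff_unique, C_diff_shift, HD, Hh. }
split.
- apply analytic_at_series; exists (fun n => INR (S n) * a (S n))%C, r; split; [exact Hr|].
  intros h Hh; rewrite HE by exact Hh; apply HG, Hh.
- exists r; split; [exact Hr|]; intros h Hh.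
  rewrite HE by exact Hh; apply C_diff_shift, HD, Hh.
Qed.

Lemma analytic_at_diff (f : C -> C) (z : C) :
  analytic_at f z -> C_diff f z (C_derive f z).
Proof.
intros Hf; destruct (proj2 (analytic_at_derive_near f z Hf)) as [d [Hd H]].
specialize (H (RtoC 0)); rewrite Cmod_0, Cplus_0_r in H; exact (H Hd).
Qed.

Lemma analytic_at_ext_loc (f g : C -> C) (z : C) (d : R) :
  0 < d -> (forall h, Cmod h < d -> f (z + h)%C = g (z + h)%C) ->
  analytic_at f z -> analytic_at g z.
Proof.
intros Hd Hfg Hf; apply analytic_at_series in Hf; destruct Hf as [a [r [Hr H]]].
apply analytic_at_series; exists a, (Rmin d r); split; [apply Rmin_pos; assumption|].
intros h Hh; pose proof (Rmin_l d r); pose proof (Rmin_r d r).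
rewrite <- Hfg by lra; apply H; lra.
Qed.

Lemma analytic_at_lincomb (f g : C -> C) (c z : C) :
  analytic_at f z -> analytic_at g z -> analytic_at (fun w => f w + c * g w)%C z.
Proof.
intros Hf Hg; apply analytic_at_series in Hf; destruct Hf as [a [r [Hr H]]].
apply analytic_at_series in Hg; destruct Hg as [b [s [Hs H']]].
apply analytic_at_series; exists (fun n => a n + c * b n)%C, (Rmin r s).
split; [apply Rmin_pos; assumption|].
intros h Hh; pose proof (Rmin_l r s); pose proof (Rmin_r r s).
pose proof (is_series_plus _ _ _ _ (H h ltac:(lra))
  (is_series_scal (K := C_AbsRing) (V := C_NormedModule) c _ _ (H' h ltac:(lra)))) as S.
revert S; apply is_series_ext; intros n.
change (a n * h ^ n + c * (b n * h ^ n) = (a n + c * b n) * h ^ n)%C; ring.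
Qed.

(** Write w = (w - z) + z: the first summand shifts the coefficients at [z], the second is a
    scalar. *)
Lemma analytic_at_id_mult (f : C -> C) (z : C) :
  analytic_at f z -> analytic_at (fun w => w * f w)%C z.
Proof.
intros Hf; apply analytic_at_series in Hf; destruct Hf as [a [r [Hr H]]].
assert (H1 : analytic_at (fun w => (w - z) * f w)%C z).
{ exists (PS_incr_1 a), r; split; [exact Hr|]; intros w Hw.
  apply (is_pseries_incr_1 (K := C_AbsRing) (V := C_NormedModule)).
  apply (C_pseries_series a (w - z)); specialize (H (w - z)%C Hw).
  replace (z + (w - z))%C with w in H by ring; exact H. }
assert (H2 : analytic_at f z) by (apply analytic_at_series; exists a, r; split; assumption).
apply (analytic_at_ext_loc (fun w => (w - z) * f w + z * f w)%C _ z 1); [lra|intros; ring|].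
apply analytic_at_lincomb; assumption.
Qed.

(** * Zeros of analytic functions: factoring out a power *)

Lemma C_series_unique (a : nat -> C) (x y : C) :
  C_series a x -> C_series a y -> x = y.
Proof.
apply (filterlim_locally_unique (K := C_AbsRing) (V := C_NormedModule)).
Qed.

Lemma C_series_at_0 (a : nat -> C) : C_series (fun n => a n * (RtoC 0) ^ n)%C (a O).
Proof.
apply (C_pseries_series a (RtoC 0)); apply (is_pseries_0 (K := C_AbsRing) (V := C_NormedModule)).
Qed.

Lemma C_series_drop (a : nat -> C) (m : nat) (l : C) :
  (forall k, (k < m)%nat -> a k = RtoC 0) -> C_series a l ->
  C_series (fun n => a (m + n)%nat) l.
Proof.
revert a; induction m as [|m IH]; intros a Ha Hl; [exact Hl|].
apply (IH (fun n => a (S n))).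
- intros k Hk; apply Ha; lia.
- apply (is_series_incr_1 (K := C_AbsRing) (V := C_NormedModule)).
  match goal with |- is_series _ ?x => replace x with l; [exact Hl|] end.
  rewrite (Ha O) by lia; change (l = l + 0)%C; ring.
Qed.

(** [G] is F(h)/h^m with the value [a m] filled in at 0. With [m = 1] it divides a function by the
    variable; general [m] describes a zero of that order. *)
Lemma C_series_factor (a : nat -> C) (F : C -> C) (r : R) (m : nat) :
  0 < r -> (forall k, (k < m)%nat -> a k = RtoC 0) ->
  (forall h, Cmod h < r -> C_series (fun n => a n * h ^ n)%C (F h)) ->
  exists G : C -> C, G (RtoC 0) = a m /\
    (forall h, Cmod h < r -> C_series (fun n => a (m + n)%nat * h ^ n)%C (G h)) /\
    (forall h, Cmod h < r -> F h = h ^ m * G h)%C.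
Proof.
intros Hr Ha HF.
exists (fun h => if Ceq_dec h (RtoC 0) then a m else (F h / h ^ m)%C).
assert (H0 : F (RtoC 0) = a O).
{ apply (C_series_unique (fun n => a n * (RtoC 0) ^ n)%C); [|apply C_series_at_0].
  apply HF; rewrite Cmod_0; exact Hr. }
split; [destruct (Ceq_dec 0 0); [reflexivity|congruence]|]; split; intros h Hh;
  (destruct (Ceq_dec h (RtoC 0)) as [E|E]).
- subst h; pose proof (C_series_at_0 (fun n => a (m + n)%nat)) as S.
  simpl in S; rewrite Nat.add_0_r in S; exact S.
- pose proof (Cpow_nz h m E) as Hm.
  assert (S : C_series (fun n => a (m + n)%nat * h ^ (m + n))%C (F h)).
  { apply (C_series_drop (fun n => a n * h ^ n)%C).
    - intros k Hk; rewrite Ha by exact Hk; ring.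
    - apply HF, Hh. }
  apply (is_series_scal (K := C_AbsRing) (V := C_NormedModule) (/ h ^ m)%C) in S.
  replace (F h / h ^ m)%C with (scal (/ h ^ m)%C (F h)).
  + revert S; apply is_series_ext; intros n; rewrite Cpow_add_r.
    change (/ h ^ m * (a (m + n)%nat * (h ^ m * h ^ n)) = a (m + n)%nat * h ^ n)%C.
    field; exact Hm.
  + change (/ h ^ m * F h = F h / h ^ m)%C; field; exact Hm.
- subst h; rewrite H0; destruct m as [|m]; [simpl; ring|].
  rewrite (Ha O) by lia; rewrite Cpow_S; ring.
- field; apply Cpow_nz, E.
Qed.

(** The order of the zero is the least index of a nonzero coefficient; if there is none, the
    function vanishes on the whole disc of the expansion. *)
Lemma analytic_at_zero_cases (f : C -> C) (z : C) :
  analytic_at f z -> f z = RtoC 0 ->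
  (exists d, 0 < d /\ forall h, Cmod h < d -> f (z + h)%C = RtoC 0) \/
  (exists (m : nat) (G : C -> C) (d : R), (0 < m)%nat /\ 0 < d /\
     analytic_at G (RtoC 0) /\ G (RtoC 0) <> RtoC 0 /\
     forall h, Cmod h < d -> f (z + h)%C = (h ^ m * G h)%C).
Proof.
intros Hf Hz; apply analytic_at_series in Hf; destruct Hf as [a [r [Hr H]]].
destruct (classic (exists m, a m <> RtoC 0)) as [Hm|Hm].
- right.
  destruct (Wf_nat.dec_inh_nat_subset_has_unique_least_element (fun m => a m <> RtoC 0)) as
    [m [[Hm0 Hmin] _]]; [intros n; apply classic|exact Hm|].
  destruct (C_series_factor a (fun h => f (z + h)%C) r m Hr) as [G [HG0 [HG HF]]].
  + intros k Hk; destruct (classic (a k = RtoC 0)) as [E|E]; [exact E|].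
    apply Hmin in E; lia.
  + exact H.
  + exists m, G, r; split; [|split; [exact Hr|split; [|split]]].
    * destruct m as [|m]; [|lia]; exfalso; apply Hm0; rewrite <- HG0.
      specialize (HF (RtoC 0)); rewrite Cmod_0 in HF; specialize (HF Hr).
      rewrite Cplus_0_r, Hz in HF; transitivity (1 * G (RtoC 0))%C; [ring|symmetry; exact HF].
    * apply analytic_at_series; exists (fun n => a (m + n)%nat), r; split; [exact Hr|].
      intros h Hh; rewrite Cplus_0_l; apply HG, Hh.
    * rewrite HG0; exact Hm0.
    * exact HF.
- left; exists r; split; [exact Hr|]; intros h Hh.
  apply (C_series_unique (fun n => a n * h ^ n)%C); [apply H, Hh|].
  apply (is_series_ext (fun n => RtoC 0 * (RtoC 0) ^ n)%C).
  + intros n; replace (a n) with (RtoC 0).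
    * change (RtoC 0 * RtoC 0 ^ n = RtoC 0 * h ^ n)%C; ring.
    * destruct (classic (a n = RtoC 0)) as [E|E]; [now symmetry|].
      exfalso; apply Hm; exists n; exact E.
  + apply (C_series_at_0 (fun _ => RtoC 0)).
Qed.

(** * Compactness and the maximum principle *)

(* Composing with atan makes the supremum finite. *)
Lemma C_compact_max (K : C -> Prop) (g : C -> R) (B : R) :
  (exists z, K z) ->
  (forall z, K z -> Cmod z <= B) ->
  (forall z, ~ K z -> exists d, 0 < d /\ forall h, Cmod h < d -> ~ K (z + h)%C) ->
  (forall z eps, K z -> 0 < eps -> exists d, 0 < d /\
     forall h, Cmod h < d -> K (z + h)%C -> g (z + h)%C < g z + eps) ->
  exists z, K z /\ forall w, K w -> g w <= g z.
Proof.
intros [z0 Hz0] HB Hcl Hg.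
destruct (completeness (fun y => exists z, K z /\ y = atan (g z))) as [S [HS1 HS2]].
{ exists (PI / 2); intros y [z [_ ->]]; left; apply atan_bound. }
{ exists (atan (g z0)), z0; split; [exact Hz0|reflexivity]. }
assert (HSle : S <= PI / 2).
{ apply HS2; intros y [z [_ ->]]; left; apply atan_bound. }
assert (HK : forall w, K w -> atan (g w) <= S).
{ intros w Hw; apply HS1; exists w; split; [exact Hw|reflexivity]. }
apply NNPP; intros Hno.
assert (Hlt : forall z, K z -> atan (g z) < S).
{ intros z Hz; destruct (Rle_lt_or_eq_dec _ _ (HK z Hz)) as [H|H]; [exact H|].
  exfalso; apply Hno; exists z; split; [exact Hz|]; intros w Hw.
  destruct (Rle_lt_dec (g w) (g z)) as [Hc|Hc]; [exact Hc|].
  apply atan_increasing in Hc; pose proof (HK w Hw); lra. }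
(* If the supremum is not attained, every point of the plane has a box on which [atan (g w)] stays
   below [S] by a fixed margin, either by semicontinuity or because the box misses [K]. One number
   serves both as the size of the box and as the margin. *)
assert (Hd : forall p : R * R, exists d : posreal, forall w : C, K w ->
  Rabs (fst w - fst p) < d -> Rabs (snd w - snd p) < d -> atan (g w) <= S - d).
{ intros [u v].
  assert (Hbox : forall d w, 0 < d -> Rabs (fst w - u) < d / 2 -> Rabs (snd w - v) < d / 2 ->
    Cmod (w - (u, v))%C < d).
  { intros d w Hd H1 H2; eapply Rle_lt_trans; [apply Cmod_2Rmax|].
    replace d with (2 * (d / 2)) by field.
    apply Rle_lt_trans with (2 * Rmax (Rabs (fst (w - (u, v))%C)) (Rabs (snd (w - (u, v))%C))).
    - apply Rmult_le_compat_r.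
      + eapply Rle_trans; [apply Rabs_pos|apply Rmax_l].
      + rewrite <- (sqrt_square 2) at 2 by lra; apply sqrt_le_1_alt; lra.
    - apply Rmult_lt_compat_l; [lra|]; apply Rmax_lub_lt; assumption. }
  destruct (classic (K (u, v))) as [Hp|Hp].
  (* [m] lies halfway between the value at this point and [S], so [tan m] is a level strictly above
     [g (u, v)] that nearby values cannot reach. *)
  - set (m := (atan (g (u, v)) + S) / 2).
    pose proof (Hlt _ Hp) as HpS; pose proof (atan_bound (g (u, v))) as Hat.
    assert (Hm : - PI / 2 < m < PI / 2) by (unfold m; lra).
    assert (Htm : g (u, v) < tan m).
    { rewrite <- (tan_atan (g (u, v))); apply tan_increasing; unfold m; lra. }
    destruct (Hg _ (tan m - g (u, v)) Hp ltac:(lra)) as [d [Hd H]].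
    assert (Hpos : 0 < Rmin (d / 2) (S - m)) by (apply Rmin_pos; unfold m; lra).
    exists (mkposreal _ Hpos); simpl; intros w Hw H1 H2.
    pose proof (Rmin_l (d / 2) (S - m)); pose proof (Rmin_r (d / 2) (S - m)).
    specialize (H (w - (u, v))%C).
    replace ((u, v) + (w - (u, v)))%C with w in H by ring.
    specialize (H (Hbox d w Hd ltac:(lra) ltac:(lra)) Hw).
    assert (Ha : atan (g w) < atan (tan m)) by (apply atan_increasing; lra).
    rewrite atan_tan in Ha by lra; lra.
  - destruct (Hcl _ Hp) as [d [Hd H]].
    assert (Hpos : 0 < d / 2) by lra.
    exists (mkposreal _ Hpos); simpl; intros w Hw H1 H2; exfalso.
    apply (H (w - (u, v))%C); [apply Hbox; assumption|].
    replace ((u, v) + (w - (u, v)))%C with w by ring; exact Hw. }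
destruct (choice _ Hd) as [delta Hdelta].
(* Compactness of the square gives one margin [d] valid on all of [K], so [S - d] would be a smaller
   upper bound. The covering statement is doubly negated, which is why it is used only under a
   contradiction. *)
destruct (compactness_value_2d (- B) B (- B) B (fun u v => delta (u, v))) as [d Hcov].
assert (HSd : S <= S - d).
{ apply HS2; intros y [w [Hw ->]].
  destruct (Rle_lt_dec (atan (g w)) (S - d)) as [Hc|Hc]; [exact Hc|exfalso].
  pose proof (HB w Hw); pose proof (re_le_Cmod w) as Hre; pose proof (Rabs_Im_le_Cmod w) as Him.
  apply Rabs_le_between in Hre; apply Rabs_le_between in Him.
  unfold Re in Hre; unfold Im in Him.
  apply (Hcov (fst w) (snd w)); [lra|lra|].
  intros [u [v [_ [_ [H1 [H2 H3]]]]]].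
  pose proof (Hdelta (u, v) w Hw H1 H2); lra. }
pose proof (cond_pos d); lra.
Qed.

(** * Arguments, one-sided derivatives and directions *)

(** Since [atan k] is below PI/2, the angle stays where the cosine is positive and the tangent
    increases. The first conclusion serves the nonvanishing of f', the second the final
    contradiction. *)
Lemma Carg_bound (w : C) (k : R) :
  Rabs (Carg w) < atan k -> 0 < Re w /\ Rabs (Im w) < k * Re w.
Proof.
intros H.
pose proof (atan_bound k) as Hk.
assert (Hw : w <> RtoC 0).
{ intros ->; unfold Carg in H; simpl in H; unfold Rdiv in H; rewrite Rmult_0_l, acos_0 in H.
  destruct (Rlt_dec 0 0) as [Hc|_]; [lra|].
  rewrite Rabs_pos_eq in H by (pose proof PI_RGT_0; lra); lra. }
destruct (Carg_spec w Hw) as [_ E].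
set (t := Carg w) in *.
assert (Hm : 0 < Cmod w) by (apply Cmod_gt_0, Hw).
set (m := Cmod w) in *; clearbody m t; subst w; simpl.
apply Rabs_def2 in H.
assert (Hc : 0 < cos t) by (apply cos_gt_0; lra).
assert (Ht : Rabs (tan t) < k).
{ rewrite <- (tan_atan k); apply Rabs_def1.
  - apply tan_increasing; lra.
  - rewrite <- tan_neg; apply tan_increasing; lra. }
split; [apply Rmult_lt_0_compat; assumption|].
replace (m * sin t) with (tan t * (m * cos t)) by (unfold tan; field; lra).
rewrite Rabs_mult, (Rabs_pos_eq (m * cos t)) by nra.
apply Rmult_lt_compat_r; nra.
Qed.

Lemma is_derive_pos_near (phi : R -> R) (s l : R) :
  is_derive phi s l -> 0 < phi s ->
  exists d, 0 < d /\ forall t, Rabs (t - s) < d -> 0 < phi t.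
Proof.
intros Hphi Hpos.
assert (Hc : continuous phi s) by (apply (ex_derive_continuous phi); exists l; exact Hphi).
destruct (Hc (fun y => 0 < y)) as [d Hd].
{ exists (mkposreal _ Hpos); intros y Hy; change (Rabs (y - phi s) < phi s) in Hy.
  apply Rabs_def2 in Hy; lra. }
exists d; split; [apply cond_pos|]; intros t Ht; apply Hd, Ht.
Qed.

Lemma is_derive_right_nonneg (phi : R -> R) (l d : R) :
  0 < d -> is_derive phi 0 l -> phi 0 = 0 -> (forall t, 0 < t < d -> 0 <= phi t) -> 0 <= l.
Proof.
intros Hd Hphi H0 Hnn.
destruct (Rle_lt_dec 0 l) as [H|H]; [exact H|exfalso].
apply is_derive_Reals in Hphi.
destruct (Hphi (- l) ltac:(lra)) as [e He].
pose proof (cond_pos e); pose proof (Rmin_l d e); pose proof (Rmin_r d e).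
assert (0 < Rmin d e) by (apply Rmin_pos; lra).
set (t := Rmin d e / 2); assert (Ht : 0 < t < Rmin d e) by (unfold t; lra).
specialize (He t ltac:(lra)); rewrite Rabs_pos_eq in He by lra; specialize (He ltac:(lra)).
rewrite Rplus_0_l, H0 in He; apply Rabs_def2 in He.
specialize (Hnn t ltac:(lra)).
assert (0 <= (phi t - 0) / t) by (apply Rdiv_le_0_compat; lra).
lra.
Qed.

(** Take e = exp(-i arg(v) / m), which turns v e^m into |v|. *)
Lemma unit_direction (v : C) (m : nat) :
  (0 < m)%nat -> v <> RtoC 0 ->
  exists e : C, Cmod e = 1 /\ 0 < Re (v * e ^ m)%C.
Proof.
intros Hm Hv; destruct (Carg_spec v Hv) as [_ E].
set (t := Carg v) in *; pose proof (proj1 (Cmod_gt_0 v) Hv) as Hpos.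
assert (Hpow : forall (s : R) n, ((cos s, sin s) ^ n)%C = (cos (INR n * s), sin (INR n * s))).
{ intros s n; induction n as [|n IH].
  - simpl; rewrite Rmult_0_l, cos_0, sin_0; reflexivity.
  - rewrite Cpow_S, IH, S_INR, Rmult_plus_distr_r, Rmult_1_l, cos_plus, sin_plus.
    unfold Cmult; simpl; f_equal; ring. }
assert (HmR : INR m <> 0) by (apply not_0_INR; lia).
exists (cos (- t / INR m), sin (- t / INR m)); split.
- unfold Cmod; simpl.
  pose proof (sin2_cos2 (- t / INR m)) as H; unfold Rsqr in H.
  rewrite !Rmult_1_r, Rplus_comm, H; apply sqrt_1.
- rewrite Hpow; replace (INR m * (- t / INR m)) with (- t) by (field; exact HmR).
  rewrite E, cos_neg, sin_neg; simpl.
  pose proof (sin2_cos2 t) as H; unfold Rsqr in H.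
  replace (Cmod v * cos t * cos t - Cmod v * sin t * - sin t)
    with (Cmod v * (sin t * sin t + cos t * cos t)) by ring.
  rewrite H; lra.
Qed.

(** * The maximum principle for local quotients *)

(** This encodes analyticity of a quotient A/B without constructing its power series. The multiplied
    form also covers a removable singularity, where [A] and [B] are what remains after cancelling a
    common factor. *)
Definition locally_quotient (H : C -> C) (z : C) : Prop :=
  exists (A B : C -> C) (d : R), analytic_at A z /\ analytic_at B z /\ B z <> RtoC 0 /\
    0 < d /\ forall h, Cmod h < d -> (H (z + h) * B (z + h) = A (z + h))%C.

Lemma C_diff_near_neq0 (f : C -> C) (z l : C) :
  C_diff f z l -> f z <> RtoC 0 ->
  exists d, 0 < d /\ forall h, Cmod h < d -> f (z + h)%C <> RtoC 0.
Proof.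
intros Hf Hz; pose proof (proj1 (Cmod_gt_0 _) Hz) as Hpos.
destruct (C_diff_cont f z l Hf _ Hpos) as [d [Hd H]].
exists d; split; [exact Hd|]; intros h Hh E; specialize (H h Hh).
rewrite E in H; replace (0 - f z)%C with (- f z)%C in H by ring.
rewrite Cmod_opp in H; lra.
Qed.

Lemma Cmod_sqr_plus (x y : C) :
  Cmod (x + y)%C ^ 2 = Cmod x ^ 2 + 2 * (Re x * Re y + Im x * Im y) + Cmod y ^ 2.
Proof. rewrite !Cmod2_alt; destruct x, y; simpl; ring. Qed.

(* Writing H = A/B and c = H z, the function A - c B has an isolated zero at z or
   vanishes near z. In the first case it is h^m G(h) with G(0) <> 0, and along a
   suitable direction h it increases |A| above |c B|. *)
Lemma locally_quotient_open (H : C -> C) (z : C) :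
  locally_quotient H z -> H z <> RtoC 0 ->
  (exists d, 0 < d /\ forall h, Cmod h < d -> H (z + h)%C = H z) \/
  (forall d, 0 < d -> exists h, Cmod h < d /\ Cmod (H z) < Cmod (H (z + h)%C)).
Proof.
intros [A [B [d0 [HA [HB [HBz [Hd0 HH]]]]]]] Hz.
set (c := H z) in *.
assert (HAz : A z = (c * B z)%C).
{ unfold c; specialize (HH (RtoC 0)); rewrite Cmod_0, Cplus_0_r in HH; now rewrite HH. }
pose proof (analytic_at_diff B z HB) as HBd.
destruct (C_diff_near_neq0 B z _ HBd HBz) as [d1 [Hd1 HB1]].
destruct (analytic_at_zero_cases (fun w => A w + (- c) * B w)%C z) as
  [[d2 [Hd2 H2]]|[m [G [d2 [Hm [Hd2 [HG [HG0 H2]]]]]]]].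
{ apply analytic_at_lincomb; assumption. }
{ rewrite HAz; ring. }
- left; exists (Rmin d0 (Rmin d1 d2)); split; [repeat apply Rmin_pos; assumption|].
  intros h Hh; pose proof (Rmin_l d0 (Rmin d1 d2)); pose proof (Rmin_r d0 (Rmin d1 d2)).
  pose proof (Rmin_l d1 d2); pose proof (Rmin_r d1 d2).
  specialize (H2 h ltac:(lra)); specialize (HB1 h ltac:(lra)); specialize (HH h ltac:(lra)).
  rewrite <- HH in H2.
  replace (H (z + h)%C) with (c + (H (z + h) * B (z + h) + - c * B (z + h)) / B (z + h))%C
    by (field; exact HB1).
  rewrite H2; field; exact HB1.
- right; intros eps Heps.
  assert (HcB : (Cconj (c * B z) * G (RtoC 0))%C <> RtoC 0).
  { apply Cmult_neq_0; [|exact HG0]; intros E; apply (f_equal Cmod) in E.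
    rewrite Cmod_conj, Cmod_0 in E; apply Cmod_eq_0 in E; revert E; apply Cmult_neq_0; assumption. }
  (* In the direction [e] the leading term e^m G(0) has positive inner product with c B(z); [phi] is
     this inner product at [z + t * e], and it stays positive for small [t] by continuity. *)
  destruct (unit_direction _ m Hm HcB) as [e [He1 He2]].
  pose proof (analytic_at_diff G _ HG) as HGd.
  assert (HBd' : C_diff (fun w => 0 + c * B w)%C (z + RtoC 0 * e)%C (C_derive (fun w => 0 + c * B w)%C z)).
  { rewrite Cmult_0_l, Cplus_0_r; apply analytic_at_diff.
    apply (analytic_at_lincomb (fun _ => RtoC 0)); [|exact HB].
    apply analytic_at_series; exists (fun _ => RtoC 0), 1; split; [lra|]; intros h _.
    pose proof (C_series_at_0 (fun _ => RtoC 0)) as S.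
    revert S; apply is_series_ext; intros n.
    change (RtoC 0 * RtoC 0 ^ n = RtoC 0 * h ^ n)%C; ring. }
  assert (HGd' : C_diff G (RtoC 0 + RtoC 0 * e)%C (C_derive G (RtoC 0))).
  { rewrite Cmult_0_l, Cplus_0_r; exact HGd. }
  destruct (C_diff_line _ z e _ 0 HBd') as [B1 B2].
  destruct (C_diff_line _ _ e _ 0 HGd') as [G1 G2].
  set (em := (e ^ m)%C) in *.
  set (phi := fun t : R =>
    Re (0 + c * B (z + t * e))%C * (Re (G (0 + t * e)%C) * Re em - Im (G (0 + t * e)%C) * Im em)
    + Im (0 + c * B (z + t * e))%C * (Re (G (0 + t * e)%C) * Im em + Im (G (0 + t * e)%C) * Re em)).
  assert (Hphi : ex_derive phi 0).
  { unfold phi; cbv beta in B1, B2.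
    assert (E1 := ex_intro _ _ B1 : ex_derive _ _); assert (E2 := ex_intro _ _ B2 : ex_derive _ _).
    assert (E3 := ex_intro _ _ G1 : ex_derive _ _); assert (E4 := ex_intro _ _ G2 : ex_derive _ _).
    apply (ex_derive_plus (V := R_NormedModule)).
    - apply ex_derive_mult; [exact E1|].
      apply (ex_derive_minus (V := R_NormedModule));
        (apply ex_derive_mult; [assumption|apply ex_derive_const]).
    - apply ex_derive_mult; [exact E2|].
      apply (ex_derive_plus (V := R_NormedModule));
        (apply ex_derive_mult; [assumption|apply ex_derive_const]). }
  assert (Hphi0 : 0 < phi 0).
  { unfold phi; rewrite !Cmult_0_l, !Cplus_0_r, Cplus_0_l.
    revert He2; clear; destruct (c * B z)%C, (G (RtoC 0)), em; simpl; intros He2.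
    lra. }
  destruct Hphi as [l Hphi].
  destruct (is_derive_pos_near phi 0 l Hphi Hphi0) as [d3 [Hd3 H3]].
  set (d := Rmin eps (Rmin (Rmin d0 d1) (Rmin d2 d3))).
  assert (Hd : 0 < d) by (unfold d; repeat apply Rmin_pos; assumption).
  assert (Hdle : d <= eps /\ d <= d0 /\ d <= d1 /\ d <= d2 /\ d <= d3).
  { unfold d; pose proof (Rmin_l eps (Rmin (Rmin d0 d1) (Rmin d2 d3)));
    pose proof (Rmin_r eps (Rmin (Rmin d0 d1) (Rmin d2 d3)));
    pose proof (Rmin_l (Rmin d0 d1) (Rmin d2 d3)); pose proof (Rmin_r (Rmin d0 d1) (Rmin d2 d3));
    pose proof (Rmin_l d0 d1); pose proof (Rmin_r d0 d1); pose proof (Rmin_l d2 d3);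
    pose proof (Rmin_r d2 d3); lra. }
  set (t := d / 2).
  assert (Hth : Cmod (t * e)%C = t) by (rewrite Cmod_mult, He1, Cmod_R, Rabs_pos_eq; unfold t; lra).
  exists (t * e)%C; rewrite Hth; split; [unfold t; lra|].
  specialize (HH (t * e)%C); specialize (HB1 (t * e)%C); specialize (H2 (t * e)%C).
  rewrite Hth in HH, HB1, H2.
  specialize (HH ltac:(unfold t; lra)); specialize (HB1 ltac:(unfold t; lra));
  specialize (H2 ltac:(unfold t; lra)).
  specialize (H3 t ltac:(rewrite Rminus_0_r, Rabs_pos_eq; unfold t; lra)).
  unfold phi in H3; rewrite Cplus_0_l in H3; rewrite (Cplus_0_l (t * e)) in H3.
  set (Bt := B (z + t * e)%C) in *; set (Gt := G (t * e)%C) in *.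
  assert (HB2 : 0 < Cmod Bt) by (apply Cmod_gt_0, HB1).
  assert (HA2 : A (z + t * e)%C = (c * Bt + (t ^ m)%R * (em * Gt))%C).
  { replace (A (z + t * e)%C) with (c * Bt + (A (z + t * e) + - c * Bt))%C by ring.
    rewrite H2, Cpow_mult_l, RtoC_pow; fold em; ring. }
  apply Rmult_lt_reg_r with (Cmod Bt); [exact HB2|].
  rewrite <- !Cmod_mult, HH, HA2.
  (* Squaring gives |A|^2 = |c B|^2 + 2 t^m phi(t) + |t^m e^m G|^2, whose last two terms are
     positive and nonnegative. *)
  apply Rsqr_incrst_0; [|apply Cmod_ge_0|apply Cmod_ge_0].
  rewrite !Rsqr_pow2, Cmod_sqr_plus.
  assert (Htm : 0 < t ^ m) by (apply pow_lt; unfold t; lra).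
  pose proof (pow2_ge_0 (Cmod ((t ^ m)%R * (em * Gt))%C)).
  rewrite re_scal_l.
  replace (Im ((t ^ m)%R * (em * Gt))%C) with (t ^ m * Im (em * Gt)%C)
    by (destruct (em * Gt)%C; simpl; ring).
  assert (0 < t ^ m * (Re (c * Bt)%C * Re (em * Gt)%C + Im (c * Bt)%C * Im (em * Gt)%C)).
  { apply Rmult_lt_0_compat; [exact Htm|].
    rewrite (re_mult em Gt), (im_mult em Gt); lra. }
  lra.
Qed.

Lemma Cmod_rev_triangle (x y : C) : Cmod x - Cmod (y - x)%C <= Cmod y.
Proof.
replace x with (y + - (y - x))%C at 1 by ring.
pose proof (Cmod_triangle y (- (y - x))%C) as H; rewrite Cmod_opp in H; lra.
Qed.

Lemma Cmod_lt_open (U V : C -> C) (z lU lV : C) :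
  C_diff U z lU -> C_diff V z lV -> Cmod (U z) < Cmod (V z) ->
  exists d, 0 < d /\ forall h, Cmod h < d -> Cmod (U (z + h)%C) < Cmod (V (z + h)%C).
Proof.
intros HU HV Hlt; set (e := (Cmod (V z) - Cmod (U z)) / 2).
destruct (C_diff_cont U z lU HU e ltac:(unfold e; lra)) as [d1 [Hd1 H1]].
destruct (C_diff_cont V z lV HV e ltac:(unfold e; lra)) as [d2 [Hd2 H2]].
exists (Rmin d1 d2); split; [apply Rmin_pos; assumption|].
intros h Hh; pose proof (Rmin_l d1 d2); pose proof (Rmin_r d1 d2).
specialize (H1 h ltac:(lra)); specialize (H2 h ltac:(lra)).
pose proof (Cmod_rev_triangle (V z) (V (z + h)%C)).
pose proof (Cmod_triangle (U z) (U (z + h) - U z)%C) as Ht.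
replace (U z + (U (z + h) - U z))%C with (U (z + h)%C) in Ht by ring.
unfold e in *; lra.
Qed.

(** The function A - H(z) B vanishes at [z] and equals (H - H(z)) B nearby, where |B| is at least
    half of |B(z)|. *)
Lemma locally_quotient_cont (H : C -> C) (z : C) : locally_quotient H z ->
  forall eps, 0 < eps -> exists d, 0 < d /\
    forall h, Cmod h < d -> Cmod (H (z + h) - H z)%C < eps.
Proof.
intros [A [B [d0 [HA [HB [HBz [Hd0 HH]]]]]]] eps Heps.
assert (HAz : A z = (H z * B z)%C).
{ specialize (HH (RtoC 0)); rewrite Cmod_0, Cplus_0_r in HH; now rewrite HH. }
set (Q := fun w => (A w + - H z * B w)%C).
assert (HQ : analytic_at Q z) by (apply analytic_at_lincomb; assumption).
assert (HQz : Q z = RtoC 0) by (unfold Q; rewrite HAz; ring).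
set (m := Cmod (B z)); assert (Hm : 0 < m) by (apply Cmod_gt_0, HBz).
destruct (C_diff_cont B z _ (analytic_at_diff B z HB) (m / 2) ltac:(lra)) as [d1 [Hd1 H1]].
destruct (C_diff_cont Q z _ (analytic_at_diff Q z HQ) (eps * (m / 2)) ltac:(nra)) as [d2 [Hd2 H2]].
exists (Rmin d0 (Rmin d1 d2)); split; [repeat apply Rmin_pos; assumption|].
intros h Hh; pose proof (Rmin_l d0 (Rmin d1 d2)); pose proof (Rmin_r d0 (Rmin d1 d2)).
pose proof (Rmin_l d1 d2); pose proof (Rmin_r d1 d2).
specialize (HH h ltac:(lra)); specialize (H1 h ltac:(lra)); specialize (H2 h ltac:(lra)).
pose proof (Cmod_rev_triangle (B z) (B (z + h)%C)) as Hr; fold m in Hr.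
replace (Q (z + h)%C - Q z)%C with ((H (z + h) - H z) * B (z + h))%C in H2
  by (rewrite HQz; unfold Q; rewrite <- HH; ring).
rewrite Cmod_mult in H2.
apply Rmult_lt_reg_r with (m / 2); [lra|].
pose proof (Cmod_ge_0 (H (z + h) - H z)%C); nra.
Qed.

Lemma maximum_modulus (H : C -> C) (rho M : R) :
  0 < rho ->
  (forall z, Cmod z <= rho -> locally_quotient H z) ->
  (forall z, Cmod z = rho -> Cmod (H z) <= M) ->
  forall z, Cmod z <= rho -> Cmod (H z) <= M.
Proof.
intros Hrho HH Hbd z Hz.
assert (Hout : forall w, rho < Cmod w -> exists d, 0 < d /\
          forall h, Cmod h < d -> rho < Cmod (w + h)%C).
{ intros w Hw; exists (Cmod w - rho); split; [lra|]; intros h Hh.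
  pose proof (Cmod_rev_triangle w (w + h)%C) as Hr.
  replace (w + h - w)%C with h in Hr by ring; lra. }
destruct (C_compact_max (fun w => Cmod w <= rho) (fun w => Cmod (H w)) rho) as [z1 [Hz1 Hmax]].
{ exists z; exact Hz. }
{ tauto. }
{ intros w Hw; destruct (Hout w ltac:(lra)) as [d [Hd Hd']].
  exists d; split; [exact Hd|]; intros h Hh; specialize (Hd' h Hh); lra. }
{ intros w eps Hw Heps.
  destruct (locally_quotient_cont H w (HH w Hw) eps Heps) as [d [Hd Hd']].
  exists d; split; [exact Hd|]; intros h Hh _; specialize (Hd' h Hh).
  pose proof (Cmod_triangle (H w) (H (w + h) - H w)%C) as Ht.
  replace (H w + (H (w + h) - H w))%C with (H (w + h)%C) in Ht by ring; lra. }
(* A maximizer of largest modulus: where H is locally constant one can move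
   outward, which replaces the identity theorem. *)
destruct (C_compact_max (fun w => Cmod w <= rho /\ Cmod (H z1) <= Cmod (H w)) Cmod rho)
  as [z2 [[Hz2 Hz12] Hfar]].
{ exists z1; split; [exact Hz1|lra]. }
{ tauto. }
{ intros w Hw; destruct (Rlt_dec rho (Cmod w)) as [Hc|Hc].
  - destruct (Hout w Hc) as [d [Hd Hd']].
    exists d; split; [exact Hd|]; intros h Hh; specialize (Hd' h Hh); lra.
  - assert (Hlt : Cmod (H w) < Cmod (H z1)).
    { destruct (Rlt_dec (Cmod (H w)) (Cmod (H z1))); [assumption|exfalso; apply Hw; lra]. }
    destruct (locally_quotient_cont H w (HH w ltac:(lra)) (Cmod (H z1) - Cmod (H w)) ltac:(lra))
      as [d [Hd Hd']].
    exists d; split; [exact Hd|]; intros h Hh; specialize (Hd' h Hh).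
    pose proof (Cmod_triangle (H w) (H (w + h) - H w)%C) as Ht.
    replace (H w + (H (w + h) - H w))%C with (H (w + h)%C) in Ht by ring; lra. }
{ intros w eps Hw Heps; exists eps; split; [exact Heps|]; intros h Hh _.
  pose proof (Cmod_triangle w h); lra. }
pose proof (Hmax z Hz) as Hz'.
destruct (Rle_lt_or_eq_dec _ _ Hz2) as [Hin|Hon]; [|pose proof (Hbd z2 Hon); lra].
(* [locally_quotient_open] needs a nonzero value. If the value is 0, so is the maximum, and the
   boundary point [rho] shows that [M] is nonnegative. *)
destruct (Ceq_dec (H z2) (RtoC 0)) as [E|E].
{ rewrite E, Cmod_0 in Hz12.
  pose proof (Hbd (RtoC rho)) as Hb; rewrite Cmod_R, Rabs_pos_eq in Hb by lra.
  specialize (Hb eq_refl); pose proof (Cmod_ge_0 (H rho)); lra. }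
destruct (locally_quotient_open H z2 (HH z2 Hz2) E) as [[d [Hd Hconst]]|Hopen].
- exfalso.
  set (t := Rmin d (rho - Cmod z2) / 2).
  assert (Ht : 0 < Rmin d (rho - Cmod z2)) by (apply Rmin_pos; lra).
  pose proof (Rmin_l d (rho - Cmod z2)); pose proof (Rmin_r d (rho - Cmod z2)).
  (* A horizontal step away from the imaginary axis always increases the modulus, even from 0. *)
  assert (Hstep : exists s : R, Rabs s = t /\ Cmod z2 < Cmod (z2 + s)%C).
  { destruct (Rle_lt_dec 0 (Re z2)) as [Hs|Hs]; [exists t|exists (- t)];
      (split; [unfold t; try rewrite Rabs_Ropp; apply Rabs_pos_eq; lra|]);
      apply Rsqr_incrst_0; try apply Cmod_ge_0; rewrite !Rsqr_pow2, !Cmod2_alt;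
      assert (0 < t) by (unfold t; lra);
      destruct z2 as [x y]; simpl in *; nra. }
  destruct Hstep as [s [Hs1 Hs2]].
  assert (Hs : Cmod s = t) by (rewrite Cmod_R; exact Hs1).
  pose proof (Cmod_triangle z2 s).
  assert (Cmod (z2 + s)%C <= Cmod z2); [|lra].
  apply Hfar; split; [unfold t in Hs; lra|].
  rewrite Hconst by (unfold t in Hs; lra); exact Hz12.
- exfalso; destruct (Hopen (rho - Cmod z2) ltac:(lra)) as [h [Hh Hgt]].
  pose proof (Cmod_triangle z2 h); pose proof (Hmax (z2 + h)%C ltac:(lra)); lra.
Qed.

(** * Nonvanishing of the derivative *)

Lemma is_derive_pow_mult_sqr (n : nat) (p q : R -> R) (s p' q' : R) :
  is_derive p s p' -> is_derive q s q' ->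
  is_derive (fun t => t ^ n * (p t * p t + q t * q t)) s
    (INR n * s ^ pred n * (p s * p s + q s * q s) + s ^ n * (2 * (p s * p' + q s * q'))).
Proof.
intros Hp Hq; auto_derive.
- repeat split; eexists; eassumption.
- rewrite (is_derive_unique _ _ _ Hp : Derive (fun t => p t) s = _).
  rewrite (is_derive_unique _ _ _ Hq : Derive (fun t => q t) s = _); ring.
Qed.

(* t^n |h(t z)|^2 is nondecreasing on (0, 1] as soon as n >= 2 alpha. *)
Lemma log_derivative_neq0 (h h' : C -> C) (alpha : R) :
  0 < alpha ->
  (forall z, unit_disc z -> C_diff h z (h' z)) ->
  h (RtoC 0) <> RtoC 0 ->
  (forall z, unit_disc z -> 0 < Re (RtoC alpha + z * h' z / h z)%C) ->
  forall z, unit_disc z -> h z <> RtoC 0.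
Proof.
intros Hal Hh H0 Hre z Hz Ez.
destruct (nfloor_ex (2 * alpha) ltac:(lra)) as [n0 [_ Hn0]].
set (n := S n0); assert (Hn : 2 * alpha < INR n) by (unfold n; rewrite S_INR; lra).
assert (Hsz : forall s, 0 <= s <= 1 -> unit_disc (0 + s * z)%C).
{ intros s Hs; unfold unit_disc in *; rewrite Cplus_0_l, Cmod_mult, Cmod_R, Rabs_pos_eq by lra.
  pose proof (Cmod_ge_0 z); nra. }
set (p := fun t : R => Re (h (0 + t * z)%C)); set (q := fun t : R => Im (h (0 + t * z)%C)).
set (phi := fun t => t ^ n * (p t * p t + q t * q t)).
set (dphi := fun s => INR n * s ^ pred n * (p s * p s + q s * q s)
   + s ^ n * (2 * (p s * Re (h' (0 + s * z) * z)%C + q s * Im (h' (0 + s * z) * z)%C))).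
assert (Hder : forall s, 0 <= s <= 1 -> is_derive phi s (dphi s)).
{ intros s Hs; destruct (C_diff_line h 0 z _ s (Hh _ (Hsz s Hs))) as [D1 D2].
  apply is_derive_pow_mult_sqr; assumption. }
assert (Hnn : forall s, 0 < s <= 1 -> 0 <= dphi s).
{ intros s Hs; specialize (Hre _ (Hsz s ltac:(lra))); unfold dphi, p, q.
  set (w := (0 + s * z)%C) in *; set (v := h w) in *.
  unfold n; simpl pred; simpl pow.
  assert (Hsn : 0 < s ^ n0) by (apply pow_lt; lra).
  (* This is Re(alpha + s u/v) > 0 multiplied by |v|^2. At a zero of [h] on the segment both sides
     are 0, so such zeros do no harm. *)
  assert (Hkey : - alpha * (Re v * Re v + Im v * Im v)
            <= s * (Re v * Re (h' w * z)%C + Im v * Im (h' w * z)%C)).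
  { destruct (Ceq_dec v (RtoC 0)) as [E|E]; [rewrite E; simpl; lra|].
    assert (Hv : 0 < Re v * Re v + Im v * Im v).
    { pose proof (proj1 (Cmod_gt_0 v) E); pose proof (Cmod2_alt v); nra. }
    set (u := (h' w * z)%C) in *.
    replace (w * h' w / v)%C with (s * (u / v))%C in Hre by (unfold u, w; field; exact E).
    assert (Hmul : 0 < Re (alpha + s * (u / v))%C * (Re v * Re v + Im v * Im v))
      by (apply Rmult_lt_0_compat; assumption).
    replace (Re (alpha + s * (u / v))%C * (Re v * Re v + Im v * Im v)) with
      (alpha * (Re v * Re v + Im v * Im v) + s * (Re v * Re u + Im v * Im u)) in Hmul; [lra|].
    clear - Hv; destruct u as [u1 u2], v as [v1 v2]; simpl in *. field; nra. }
  rewrite (Rmult_comm (INR (S n0))), (Rmult_comm s), !Rmult_assoc, <- Rmult_plus_distr_l.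
  apply Rmult_le_pos; [lra|].
  assert (0 <= Re v * Re v + Im v * Im v) by nra.
  fold n; nra. }
assert (Hu0 : 0 < p 0 * p 0 + q 0 * q 0).
{ unfold p, q; rewrite Cmult_0_l, Cplus_0_l.
  pose proof (proj1 (Cmod_gt_0 _) H0); pose proof (Cmod2_alt (h (RtoC 0))); nra. }
destruct (C_diff_line h 0 z _ 0 (Hh _ (Hsz 0 ltac:(lra)))) as [D1 D2].
(* With exponent 0 the function is |h(t z)|^2 itself, positive at 0 and hence for small [t]. So
   [phi] is positive at a small [s] but 0 at 1, and the mean value theorem contradicts its
   monotonicity. *)
destruct (is_derive_pos_near (fun t => t ^ 0 * (p t * p t + q t * q t)) 0 _
  (is_derive_pow_mult_sqr 0 p q 0 _ _ D1 D2)) as [d [Hd Hpos]]; [simpl; lra|].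
set (s := Rmin d 1 / 2).
assert (Hs : 0 < s < 1 /\ s < d).
{ pose proof (Rmin_l d 1); pose proof (Rmin_r d 1).
  assert (0 < Rmin d 1) by (apply Rmin_pos; lra); unfold s; lra. }
specialize (Hpos s ltac:(rewrite Rminus_0_r, Rabs_pos_eq; lra)).
destruct (MVT_gen phi s 1 dphi) as [c [Hc Emvt]].
{ rewrite Rmin_left, Rmax_right by lra; intros x Hx; apply Hder; lra. }
{ rewrite Rmin_left, Rmax_right by lra; intros x Hx.
  apply continuity_pt_filterlim, (ex_derive_continuous phi); exists (dphi x); apply Hder; lra. }
rewrite Rmin_left, Rmax_right in Hc by lra.
assert (E1 : phi 1 = 0).
{ unfold phi, p, q; rewrite Cmult_1_l, Cplus_0_l, Ez; simpl; ring. }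
assert (Hphis : 0 < phi s).
{ simpl in Hpos; unfold phi; apply Rmult_lt_0_compat; [apply pow_lt; lra|lra]. }
pose proof (Hnn c ltac:(lra)); nra.
Qed.

(** * The quotient (z f' - f) / (z f' + f) *)

Lemma analytic_at_divide_id (f : C -> C) :
  analytic_at f (RtoC 0) -> f (RtoC 0) = RtoC 0 ->
  exists (G : C -> C) (d : R), analytic_at G (RtoC 0) /\ G (RtoC 0) = C_derive f (RtoC 0) /\
    0 < d /\
    forall h, Cmod h < d -> f h = (h * G h)%C /\ C_derive f h = (G h + h * C_derive G h)%C.
Proof.
intros Hf Hf0; apply analytic_at_series in Hf; destruct Hf as [a [r [Hr H]]].
destruct (C_series_factor a (fun h => f (0 + h)%C) r 1 Hr) as [G [_ [HG HF]]].
{ intros k Hk; replace k with O by lia.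
  apply (C_series_unique (fun n => a n * (RtoC 0) ^ n)%C); [apply C_series_at_0|].
  specialize (H (RtoC 0)); rewrite Cmod_0, Cplus_0_r, Hf0 in H; exact (H Hr). }
{ exact H. }
assert (HGa : analytic_at G (RtoC 0)).
{ apply analytic_at_series; exists (fun n => a (1 + n)%nat), r; split; [exact Hr|].
  intros h Hh; rewrite Cplus_0_l; apply HG, Hh. }
assert (HfG : forall h, Cmod h < r -> f h = (h * G h)%C).
{ intros h Hh; specialize (HF h Hh); rewrite Cplus_0_l in HF; rewrite HF; simpl; ring. }
destruct (proj2 (analytic_at_derive_near G _ HGa)) as [d [Hd HD]].
assert (Hder : forall h, Cmod h < Rmin d r -> C_derive f h = (G h + h * C_derive G h)%C).
{ intros h Hh; pose proof (Rmin_l d r); pose proof (Rmin_r d r).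
  apply C_diff_unique.
  apply (C_diff_ext_loc (fun w => w * G w)%C f h _ (r - Cmod h)); [lra| |].
  - intros k Hk; pose proof (Cmod_triangle h k); symmetry; apply HfG; lra.
  - apply C_diff_id_mult; specialize (HD h ltac:(lra)); rewrite Cplus_0_l in HD; exact HD. }
assert (Hdr : 0 < Rmin d r) by (apply Rmin_pos; assumption).
exists G, (Rmin d r); split; [exact HGa|]; split; [|split; [exact Hdr|]].
- rewrite Hder by (rewrite Cmod_0; exact Hdr); ring.
- intros h Hh; split; [|apply Hder, Hh].
  apply HfG; pose proof (Rmin_r d r); lra.
Qed.

(** With q = z f'/f, the Cayley transform (q - 1)/(q + 1) is [zder_minus] over [zder_plus]; they are
    kept apart because [f] is not yet known to be nonzero. *)
Definition zder_minus (f : C -> C) (z : C) : C := (z * C_derive f z - f z)%C.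
Definition zder_plus (f : C -> C) (z : C) : C := (z * C_derive f z + f z)%C.

Lemma analytic_at_zder (f : C -> C) (z : C) :
  analytic_at f z -> analytic_at (zder_minus f) z /\ analytic_at (zder_plus f) z.
Proof.
intros Hf.
assert (Hg : analytic_at (fun w => w * C_derive f w)%C z)
  by (apply analytic_at_id_mult, analytic_at_derive_near, Hf).
split.
- apply (analytic_at_ext_loc (fun w => w * C_derive f w + - (1) * f w)%C _ z 1);
    [lra|intros; unfold zder_minus; ring|].
  apply analytic_at_lincomb; assumption.
- apply (analytic_at_ext_loc (fun w => w * C_derive f w + 1 * f w)%C _ z 1);
    [lra|intros; unfold zder_plus; ring|].
  apply analytic_at_lincomb; assumption.
Qed.

(** With f = z G one has z f' - f = z^2 G' and z f' + f = z (2 G + z G'), where G(0) = f'(0) = 1. So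
    the quotient has a removable singularity at 0 with value 0. *)
Lemma zder_near_0 (f : C -> C) : class_A f ->
  exists (A B : C -> C) (d : R),
    analytic_at A (RtoC 0) /\ analytic_at B (RtoC 0) /\ B (RtoC 0) = RtoC 2 /\ 0 < d /\
    forall h, Cmod h < d ->
      zder_minus f h = (h * (h * A h))%C /\ zder_plus f h = (h * B h)%C.
Proof.
intros [Hf [Hf0 Hf1]].
assert (Hd0 : unit_disc 0) by (unfold unit_disc; rewrite Cmod_0; lra).
destruct (analytic_at_divide_id f (Hf _ Hd0) Hf0) as [G [d [HG [HG0 [Hd H]]]]].
pose proof (proj1 (analytic_at_derive_near G _ HG)) as HG'.
exists (C_derive G), (fun h => h * C_derive G h + 2 * G h)%C, d.
split; [exact HG'|]; split; [|split; [rewrite HG0, Hf1; ring|split; [exact Hd|]]].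
- apply analytic_at_lincomb; [apply analytic_at_id_mult|]; assumption.
- intros h Hh; destruct (H h Hh) as [E1 E2].
  unfold zder_minus, zder_plus; rewrite E1, E2; split; ring.
Qed.

(** After cancelling |h| the comparison is between h A(h) and B(h), which are 0 and 2 at the origin.
    At [h = 0] itself both original sides vanish. *)
Lemma Cmod_zder_lt_near_0 (f : C -> C) : class_A f ->
  exists d, 0 < d /\ forall h, h <> RtoC 0 -> Cmod h < d ->
    Cmod (zder_minus f h) < Cmod (zder_plus f h).
Proof.
intros Hf; destruct (zder_near_0 f Hf) as [A [B [d [HA [HB [HB0 [Hd H]]]]]]].
destruct (Cmod_lt_open (fun h => h * A h)%C B (RtoC 0) _ _
  (analytic_at_diff _ _ (analytic_at_id_mult _ _ HA)) (analytic_at_diff _ _ HB)) as [e [He H']].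
{ rewrite Cmult_0_l, Cmod_0, HB0, Cmod_R, Rabs_pos_eq; lra. }
exists (Rmin d e); split; [apply Rmin_pos; assumption|]; intros h Hh0 Hh.
pose proof (Rmin_l d e); pose proof (Rmin_r d e).
destruct (H h ltac:(lra)) as [-> ->]; specialize (H' h ltac:(lra)).
rewrite Cplus_0_l in H'; rewrite (Cmod_mult h (h * A h)), (Cmod_mult h (B h)).
apply Rmult_lt_compat_l; [apply Cmod_gt_0, Hh0|exact H'].
Qed.

(* Schwarz's lemma for (z f' - f) / (z f' + f): the maximum principle applied to
   its quotient by z. *)
Lemma zder_schwarz (f : C -> C) (rho : R) :
  class_A f -> (forall z, unit_disc z -> C_derive f z <> RtoC 0) -> 0 < rho < 1 ->
  (forall z, 0 < Cmod z < rho -> Cmod (zder_minus f z) < Cmod (zder_plus f z)) ->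
  (forall z, Cmod z = rho -> Cmod (zder_minus f z) <= Cmod (zder_plus f z)) ->
  forall z, 0 < Cmod z <= rho ->
    rho * Cmod (zder_minus f z) <= Cmod z * Cmod (zder_plus f z).
Proof.
intros Hf Hf' Hrho Hin Hon.
(* If the denominator vanished, the inequality would make the numerator vanish too, and their sum 2
   z f' would be 0. *)
assert (HD : forall z, 0 < Cmod z <= rho -> zder_plus f z <> RtoC 0).
{ intros z Hz E.
  assert (Hle : Cmod (zder_minus f z) <= 0).
  { rewrite <- Cmod_0, <- E; destruct (Rlt_dec (Cmod z) rho).
    - left; apply Hin; lra.
    - apply Hon; lra. }
  assert (E' : zder_minus f z = RtoC 0) by (apply Cmod_eq_0; pose proof (Cmod_ge_0 (zder_minus f z)); lra).
  assert (Hz0 : z <> RtoC 0) by (apply Cmod_gt_0; lra).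
  apply (Cmult_neq_0 z (C_derive f z) Hz0); [apply Hf'; unfold unit_disc; lra|].
  replace (z * C_derive f z)%C with ((zder_plus f z + zder_minus f z) / 2)%C
    by (unfold zder_plus, zder_minus; field).
  rewrite E, E'; field. }
destruct (zder_near_0 f Hf) as [A [B [d [HA [HB [HB0 [Hd H]]]]]]].
(* Near 0 this is z^2 A / (z^2 B) = A/B with B(0) = 2, which dictates the value at 0. *)
set (Q := fun z => if Ceq_dec z (RtoC 0) then (A (RtoC 0) / 2)%C
                   else (zder_minus f z / (z * zder_plus f z))%C).
assert (HQ : forall z, Cmod z <= rho -> locally_quotient Q z).
{ intros z Hz; destruct (Ceq_dec z (RtoC 0)) as [E|E].
  - subst z.
    destruct (C_diff_near_neq0 B (RtoC 0) _ (analytic_at_diff B _ HB)) as [e [He HBe]].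
    { rewrite HB0; intros E; injection E; lra. }
    exists A, B, (Rmin d e); split; [exact HA|]; split; [exact HB|].
    split; [rewrite HB0; intros E; injection E; lra|].
    split; [apply Rmin_pos; assumption|]; intros h Hh.
    pose proof (Rmin_l d e); pose proof (Rmin_r d e).
    specialize (HBe h ltac:(lra)); rewrite Cplus_0_l in *; unfold Q.
    destruct (Ceq_dec h (RtoC 0)) as [E|E].
    + subst h; rewrite HB0; field.
    + destruct (H h ltac:(lra)) as [-> ->]; field; split; assumption.
  - assert (Hz0 : 0 < Cmod z) by (apply Cmod_gt_0, E).
    destruct (analytic_at_zder f z) as [Hm Hp]; [apply Hf; unfold unit_disc; lra|].
    assert (Hzp : analytic_at (fun w => w * zder_plus f w)%C z) by (apply analytic_at_id_mult, Hp).
    assert (Hne : (z * zder_plus f z)%C <> RtoC 0) by (apply Cmult_neq_0; [exact E|apply HD; lra]).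
    destruct (C_diff_near_neq0 _ z _ (analytic_at_diff _ _ Hzp) Hne) as [e [He Hnear]].
    exists (zder_minus f), (fun w => w * zder_plus f w)%C, e; repeat (split; [assumption|]).
    intros h Hh; specialize (Hnear h Hh); unfold Q.
    destruct (Ceq_dec (z + h)%C (RtoC 0)) as [E0|E0].
    + exfalso; apply Hnear; rewrite E0; ring.
    + unfold Cdiv; rewrite <- Cmult_assoc, Cinv_l by exact Hnear; ring. }
assert (HQz : forall z, 0 < Cmod z <= rho ->
  Cmod (Q z) = Cmod (zder_minus f z) / (Cmod z * Cmod (zder_plus f z))).
{ intros z Hz; unfold Q; assert (Hz0 : z <> RtoC 0) by (apply Cmod_gt_0; lra).
  destruct (Ceq_dec z (RtoC 0)) as [E|E]; [contradiction|].
  rewrite Cmod_div, Cmod_mult; [reflexivity|].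
  apply Cmult_neq_0; [exact E|apply HD, Hz]. }
intros z Hz.
pose proof (maximum_modulus Q rho (/ rho) ltac:(lra) HQ) as Hmax.
assert (Hpos : forall w, 0 < Cmod w <= rho -> 0 < Cmod (zder_plus f w))
  by (intros w Hw; apply Cmod_gt_0, HD, Hw).
specialize (Hmax ltac:(intros w Hw; rewrite HQz by lra;
  specialize (Hpos w ltac:(lra)); specialize (Hon w Hw); rewrite Hw;
  apply Rle_div_l; [nra|]; replace (/ rho * (rho * Cmod (zder_plus f w)))
    with (Cmod (zder_plus f w)) by (field; lra); exact Hon) z ltac:(lra)).
rewrite HQz in Hmax by exact Hz; specialize (Hpos z Hz).
apply Rle_div_l in Hmax; [|nra].
apply (Rmult_le_compat_l rho) in Hmax; [|lra].
replace (rho * (/ rho * (Cmod z * Cmod (zder_plus f z))))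
  with (Cmod z * Cmod (zder_plus f z)) in Hmax by (field; lra).
exact Hmax.
Qed.

(** * The first failure of starlikeness *)

(** A point of least modulus is a maximum of -|z| over the failures. Removing 0 leaves that set
    closed, because [Cmod_zder_lt_near_0] keeps failures away from the origin. *)
Lemma first_touching_point (f : C -> C) (z1 : C) :
  class_A f -> unit_disc z1 -> z1 <> RtoC 0 ->
  Cmod (zder_plus f z1) <= Cmod (zder_minus f z1) ->
  exists z0, unit_disc z0 /\ z0 <> RtoC 0 /\
    Cmod (zder_plus f z0) = Cmod (zder_minus f z0) /\
    (forall z, 0 < Cmod z < Cmod z0 -> Cmod (zder_minus f z) < Cmod (zder_plus f z)) /\
    (forall z, Cmod z = Cmod z0 -> Cmod (zder_minus f z) <= Cmod (zder_plus f z)).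
Proof.
intros Hf Hz1 Hz10 Hbad; unfold unit_disc in *.
destruct (Cmod_zder_lt_near_0 f Hf) as [d0 [Hd0 Hnear]].
assert (Hdiff : forall z, Cmod z < 1 -> C_diff (zder_minus f) z (C_derive (zder_minus f) z) /\
                                       C_diff (zder_plus f) z (C_derive (zder_plus f) z)).
{ intros z Hz; destruct (analytic_at_zder f z) as [Hm Hp]; [apply Hf, Hz|].
  split; apply analytic_at_diff; assumption. }
destruct (C_compact_max (fun z => z <> RtoC 0 /\ Cmod z <= Cmod z1 /\
            Cmod (zder_plus f z) <= Cmod (zder_minus f z)) (fun z => - Cmod z) (Cmod z1))
  as [z0 [[Hz0 [Hz01 Hz0b]] Hmin]].
{ exists z1; repeat split; [exact Hz10|lra|exact Hbad]. }
{ tauto. }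
{ intros z Hz; destruct (Ceq_dec z (RtoC 0)) as [E|E].
  - exists d0; split; [exact Hd0|]; intros h Hh [Hc1 [_ Hc2]]; subst z.
    rewrite Cplus_0_l in *; pose proof (Hnear h Hc1 Hh); lra.
  - destruct (Rlt_dec (Cmod z1) (Cmod z)) as [Hout|Hin].
    + exists (Cmod z - Cmod z1); split; [lra|]; intros h Hh [_ [Hc _]].
      pose proof (Cmod_rev_triangle z (z + h)%C) as Hr.
      replace (z + h - z)%C with h in Hr by ring; lra.
    + destruct (Hdiff z ltac:(lra)) as [Hm Hp].
      destruct (Cmod_lt_open _ _ z _ _ Hm Hp) as [d [Hd H]].
      { destruct (Rlt_dec (Cmod (zder_minus f z)) (Cmod (zder_plus f z))); [assumption|].
        exfalso; apply Hz; split; [exact E|lra]. }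
      exists d; split; [exact Hd|]; intros h Hh [_ [_ Hc]]; specialize (H h Hh); lra. }
{ intros z eps _ Heps; exists eps; split; [exact Heps|]; intros h Hh _.
  pose proof (Cmod_rev_triangle z (z + h)%C) as Hr.
  replace (z + h - z)%C with h in Hr by ring; lra. }
assert (Hrho : 0 < Cmod z0) by (apply Cmod_gt_0, Hz0).
assert (Hin : forall z, 0 < Cmod z < Cmod z0 -> Cmod (zder_minus f z) < Cmod (zder_plus f z)).
{ intros z Hz; destruct (Rlt_dec (Cmod (zder_minus f z)) (Cmod (zder_plus f z))) as [H|H];
    [exact H|exfalso].
  assert (- Cmod z <= - Cmod z0); [|lra].
  apply Hmin; split; [apply Cmod_gt_0; lra|split; lra]. }
(* A strict reverse inequality on the circle would persist at (1 - t) z for small [t], inside the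
   circle. *)
assert (Hon : forall z, Cmod z = Cmod z0 -> Cmod (zder_minus f z) <= Cmod (zder_plus f z)).
{ intros z Hz; destruct (Rle_lt_dec (Cmod (zder_minus f z)) (Cmod (zder_plus f z))) as [H|H];
    [exact H|exfalso].
  destruct (Hdiff z ltac:(lra)) as [Hm Hp].
  destruct (Cmod_lt_open _ _ z _ _ Hp Hm H) as [d [Hd Hnb]].
  pose proof (Rmin_l d 1); pose proof (Rmin_r d 1).
  assert (0 < Rmin d 1) by (apply Rmin_pos; lra).
  set (t := Rmin d 1 / 2); assert (Ht : 0 < t < 1 /\ t < d) by (unfold t; lra).
  specialize (Hnb ((- t)%R * z)%C); rewrite Cmod_mult, Cmod_R, Rabs_Ropp, Rabs_pos_eq in Hnb by lra.
  specialize (Hnb ltac:(nra)).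
  replace (z + (- t)%R * z)%C with ((1 - t)%R * z)%C in Hnb
    by (rewrite RtoC_minus, RtoC_opp; ring).
  specialize (Hin ((1 - t)%R * z)%C); rewrite Cmod_mult, Cmod_R, Rabs_pos_eq in Hin by lra.
  specialize (Hin ltac:(nra)); lra. }
exists z0; split; [lra|]; split; [exact Hz0|]; split; [|split; assumption].
apply Rle_antisym; [exact Hz0b|apply Hon; reflexivity].
Qed.

(** * First-order conditions at the touching point *)

(** This is the real inner product Re(conj(x) y). Its sign at [f z] and z f' is that of Re(z f'/f)
    wherever [f] is nonzero, and it needs no division. *)
Definition re_dot (x y : C) : R := Re x * Re y + Im x * Im y.

Lemma Cmod_sqr_zder (f : C -> C) (z : C) :
  Cmod (zder_plus f z) ^ 2 - Cmod (zder_minus f z) ^ 2 = 4 * re_dot (f z) (z * C_derive f z)%C.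
Proof.
unfold zder_plus, zder_minus, re_dot; rewrite !Cmod2_alt.
destruct (z * C_derive f z)%C, (f z); simpl; ring.
Qed.

Lemma is_derive_re_dot_line (F G : C -> C) (z v lF lG : C) :
  C_diff F z lF -> C_diff G z lG ->
  is_derive (fun t : R => re_dot (F (z + t * v)%C) (G (z + t * v)%C)) 0
    (re_dot (lF * v)%C (G z) + re_dot (F z) (lG * v)%C).
Proof.
intros HF HG.
assert (E : z = (z + RtoC 0 * v)%C) by ring.
rewrite E in HF, HG.
destruct (C_diff_line F z v lF 0 HF) as [F1 F2]; destruct (C_diff_line G z v lG 0 HG) as [G1 G2].
unfold re_dot.
pose proof (is_derive_plus _ _ _ _ _
  (is_derive_mult _ _ _ _ _ F1 G1 Rmult_comm) (is_derive_mult _ _ _ _ _ F2 G2 Rmult_comm)) as H.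
match type of H with is_derive _ _ ?x =>
  match goal with |- is_derive _ _ ?y => replace y with x end end; [exact H|].
change plus with Rplus; change mult with Rmult; cbv beta; rewrite <- !E.
match goal with |- ?x = ?y => change (@eq R x y) end; ring.
Qed.

Lemma Rmult_eq_0_of_small (x y : R) :
  (forall eps, 0 < eps -> x <= eps * y) -> (forall eps, 0 < eps -> - x <= eps * y) -> x = 0.
Proof.
intros H1 H2; destruct (Req_dec x 0) as [E|E]; [exact E|exfalso].
assert (Hx : 0 < Rabs x) by (apply Rabs_pos_lt, E).
pose proof (Rabs_pos y); pose proof (Rle_abs y).
set (e := Rabs x / (2 * (Rabs y + 1))).
assert (He : 0 < e) by (unfold e; apply Rdiv_lt_0_compat; lra).
assert (Hey : e * (Rabs y + 1) = Rabs x / 2) by (unfold e; field; lra).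
specialize (H1 e He); specialize (H2 e He).
assert (Rabs x <= e * y) by (unfold Rabs; destruct (Rcase_abs x); lra).
nra.
Qed.

Lemma touching_conditions (f : C -> C) (z0 : C) :
  class_A f -> (forall z, unit_disc z -> C_derive f z <> RtoC 0) ->
  unit_disc z0 -> z0 <> RtoC 0 ->
  Cmod (zder_plus f z0) = Cmod (zder_minus f z0) ->
  (forall z, 0 < Cmod z < Cmod z0 -> Cmod (zder_minus f z) < Cmod (zder_plus f z)) ->
  (forall z, Cmod z = Cmod z0 -> Cmod (zder_minus f z) <= Cmod (zder_plus f z)) ->
  let P := (1 + z0 * C_derive (C_derive f) z0 / C_derive f z0)%C in
  exists b : R, b * Re P = 0 /\ b * Im P <= - (3 + b * b) / 2.
Proof.
intros Hf Hf' Hz0 Hz00 Htouch Hin Hon P.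
set (rho := Cmod z0); assert (Hrho : 0 < rho < 1) by (split; [apply Cmod_gt_0, Hz00|exact Hz0]).
set (G := fun z => (z * C_derive f z)%C).
set (g0 := G z0).
assert (Hg0 : g0 <> RtoC 0) by (apply Cmult_neq_0; [exact Hz00|apply Hf', Hz0]).
pose proof (Hf' z0 Hz0) as Hd0.
assert (Hdf : C_diff f z0 (C_derive f z0)) by (apply analytic_at_diff, Hf, Hz0).
assert (HdG : C_diff G z0 (C_derive f z0 + z0 * C_derive (C_derive f) z0)%C).
{ apply C_diff_id_mult, analytic_at_diff, analytic_at_derive_near, Hf, Hz0. }
assert (HE0 : re_dot (f z0) g0 = 0).
{ pose proof (Cmod_sqr_zder f z0) as H; rewrite Htouch in H; unfold g0, G; lra. }
set (m := Re g0 * Re g0 + Im g0 * Im g0).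
assert (Hm : 0 < m).
{ pose proof (proj1 (Cmod_gt_0 _) Hg0); pose proof (Cmod2_alt g0); unfold m; nra. }
(* [b] is Im(f/g) at [z0]; since [re_dot] vanishes there, f = i b g, which the next two assertions
   state in coordinates. *)
set (b := (Im (f z0) * Re g0 - Re (f z0) * Im g0) / m).
assert (Hf1 : Re (f z0) = - b * Im g0).
{ unfold re_dot in HE0; unfold b.
  replace (Re (f z0)) with (Re (f z0) * m / m) at 1 by (field; lra).
  replace (Re (f z0) * m) with (Re g0 * (Re (f z0) * Re g0 + Im (f z0) * Im g0)
     - Im g0 * (Im (f z0) * Re g0 - Re (f z0) * Im g0)) by (unfold m; ring).
  rewrite HE0; field; lra. }
assert (Hf2 : Im (f z0) = b * Re g0).
{ unfold re_dot in HE0; unfold b.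
  replace (Im (f z0)) with (Im (f z0) * m / m) at 1 by (field; lra).
  replace (Im (f z0) * m) with (Im g0 * (Re (f z0) * Re g0 + Im (f z0) * Im g0)
     + Re g0 * (Im (f z0) * Re g0 - Re (f z0) * Im g0)) by (unfold m; ring).
  rewrite HE0; field; lra. }
(* [E c] follows the inner product of f and g along z0 (1 + t c). Its slope comes from z f' = g and
   z g' = P g together with f = i b g. *)
set (E := fun (c : C) (t : R) => re_dot (f (z0 + t * (c * z0))%C) (G (z0 + t * (c * z0))%C)).
assert (HE : forall c, is_derive (E c) 0 (m * (Re c + b * Im (c * P)%C))).
{ intros c.
  pose proof (is_derive_re_dot_line f G z0 (c * z0)%C _ _ Hdf HdG) as H.
  match type of H with is_derive _ _ ?x =>
    replace x with (m * (Re c + b * Im (c * P)%C)) in H; [exact H|] end.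
  replace (C_derive f z0 * (c * z0))%C with (c * g0)%C by (unfold g0, G; ring).
  replace ((C_derive f z0 + z0 * C_derive (C_derive f) z0) * (c * z0))%C with (c * P * g0)%C
    by (unfold P, g0, G; field; exact Hd0).
  fold g0; unfold re_dot, m; rewrite Hf1, Hf2.
  destruct (c * P)%C, c, g0; simpl; ring. }
assert (Hline : forall c t, (z0 + RtoC t * (c * z0))%C = ((1 + t * c) * z0)%C) by (intros; ring).
assert (Hle : forall z, 0 < Cmod z <= rho -> Cmod (zder_minus f z) <= Cmod (zder_plus f z)).
{ intros z Hz; destruct (Rlt_dec (Cmod z) rho).
  - left; apply Hin; fold rho; lra.
  - apply Hon; fold rho; lra. }
exists b; split.
(* The tangential directions c = i and c = -i leave the disc, so they are tilted inward by [eps];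
   letting [eps] tend to 0 for both signs forces b Re P = 0. *)
- assert (Hdir : forall eps sg, 0 < eps -> sg * sg = 1 ->
      0 <= - eps * (1 + b * Im P) + sg * (b * Re P)).
  { intros eps sg Heps Hsg.
    set (c := (- eps, sg) : C).
    (* Since |1 + t c|^2 = 1 - 2 t eps + t^2 (eps^2 + 1), every positive [t] below [d] stays inside
       the disc. *)
    set (d := eps / (eps * eps + 1)).
    assert (Hd : 0 < d) by (unfold d; apply Rdiv_lt_0_compat; nra).
    assert (H : 0 <= m * (Re c + b * Im (c * P)%C)).
    { apply (is_derive_right_nonneg (E c) _ d Hd (HE c)).
      - unfold E; rewrite Cmult_0_l, Cplus_0_r; exact HE0.
      - intros t Ht; unfold E; rewrite Hline.
        set (w := (1 + t * c)%C).
        assert (Htd : t * (eps * eps + 1) < eps).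
        { apply Rlt_le_trans with (d * (eps * eps + 1)).
          - apply Rmult_lt_compat_r; nra.
          - right; unfold d; field; nra. }
        assert (Hteps : t * eps < 1) by nra.
        assert (Hw2 : Cmod w ^ 2 = (1 - t * eps) * (1 - t * eps) + t * t * (sg * sg)).
        { rewrite Cmod2_alt; unfold w, c; simpl; ring. }
        rewrite Hsg in Hw2.
        assert (Hw : 0 < Cmod w <= 1).
        { pose proof (Cmod_ge_0 w).
          assert (t * (t * (eps * eps + 1)) < t * eps) by (apply Rmult_lt_compat_l; lra).
          assert (0 < t * eps) by nra.
          simpl pow in Hw2; split; nra. }
        assert (Hwz : 0 < Cmod (w * z0)%C <= rho) by (rewrite Cmod_mult; fold rho; nra).
        specialize (Hle _ Hwz); pose proof (Cmod_sqr_zder f (w * z0)%C) as Hs.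
        pose proof (Cmod_ge_0 (zder_minus f (w * z0)%C)); unfold G; nra. }
    replace (Re c + b * Im (c * P)%C) with (- eps * (1 + b * Im P) + sg * (b * Re P)) in H
      by (unfold c; destruct P; simpl; ring).
    nra. }
  apply Rmult_eq_0_of_small with (- (1 + b * Im P)); intros eps Heps.
  + pose proof (Hdir eps (- 1) Heps ltac:(ring)); lra.
  + pose proof (Hdir eps 1 Heps ltac:(ring)); lra.
- set (c := (- (1))%C).
  set (V := fun t : R => re_dot (zder_plus f (z0 + t * (c * z0))%C) (zder_plus f (z0 + t * (c * z0))%C)).
  assert (HdD : C_diff (zder_plus f) z0 (C_derive (zder_plus f) z0))
    by (apply analytic_at_diff, analytic_at_zder, Hf, Hz0).
  pose proof (is_derive_re_dot_line _ _ z0 (c * z0)%C _ _ HdD HdD : is_derive V 0 _) as HV.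
  set (lV := re_dot _ _ + re_dot _ _) in HV.
  (* |z f' + f|^2 |z|^2 - rho^2 |z f' - f|^2 at (1 - t) z0, divided by rho^2 *)
  set (Phi := fun t => V t * (t * t - 2 * t) + 4 * E c t).
  assert (HPhi : is_derive Phi 0 (V 0 * (- 2) + 4 * (m * (Re c + b * Im (c * P)%C)))).
  { unfold Phi; specialize (HE c); auto_derive.
    - repeat split; eexists; eassumption.
    - rewrite (is_derive_unique _ _ _ HE : Derive (fun t => E c t) 0 = _).
      rewrite (is_derive_unique _ _ _ HV : Derive (fun t => V t) 0 = _); ring. }
  assert (H : 0 <= V 0 * (- 2) + 4 * (m * (Re c + b * Im (c * P)%C))).
  { apply (is_derive_right_nonneg Phi _ 1 Rlt_0_1 HPhi).
    - unfold Phi, E; rewrite Cmult_0_l, Cplus_0_r; fold g0; rewrite HE0; ring.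
    - intros t Ht; unfold Phi, E, V; rewrite Hline.
      replace ((1 + t * c) * z0)%C with ((1 - t)%R * z0)%C
        by (unfold c; rewrite RtoC_minus; ring).
      set (w := ((1 - t)%R * z0)%C).
      assert (Hw : Cmod w = (1 - t) * rho).
      { unfold w; rewrite Cmod_mult, Cmod_R, Rabs_pos_eq by lra; reflexivity. }
      pose proof (zder_schwarz f rho Hf Hf' Hrho Hin Hon w ltac:(rewrite Hw; nra)) as Hs.
      rewrite Hw in Hs.
      assert (Hs' : Cmod (zder_minus f w) <= (1 - t) * Cmod (zder_plus f w)).
      { apply Rmult_le_reg_l with rho; lra. }
      pose proof (Cmod_sqr_zder f w) as Hq; fold (G w) in Hq.
      replace (re_dot (zder_plus f w) (zder_plus f w)) with (Cmod (zder_plus f w) ^ 2)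
        by (rewrite Cmod2_alt; unfold re_dot; ring).
      pose proof (Cmod_ge_0 (zder_minus f w)); nra. }
  assert (HV0 : V 0 = m * (1 + b * b)).
  { unfold V; rewrite Cmult_0_l, Cplus_0_r; unfold re_dot.
    change (Re (zder_plus f z0)) with (Re g0 + Re (f z0)).
    change (Im (zder_plus f z0)) with (Im g0 + Im (f z0)).
    rewrite Hf1, Hf2; unfold m; ring. }
  (* The slope of [Phi] is now -2 m (1 + b^2) - 4 m (1 + b Im P) >= 0; dividing by 4 m gives the
     second condition. *)
  rewrite HV0 in H.
  replace (Re c + b * Im (c * P)%C) with (- (1 + b * Im P)) in H
    by (unfold c; destruct P; simpl; ring).
  nra.
Qed.

Theorem theorem1 :
  forall (f : C -> C) (alpha : R),
    class_A f ->
    1 < alpha ->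
    (forall z : C, unit_disc z ->
       Rabs (Carg (RtoC alpha + z * C_derive (C_derive f) z / C_derive f z)%C)
       < atan (sqrt 3 / (alpha - 1))) ->
    starlike f.
Proof.
intros f alpha Hf Hal Harg.
assert (Hf' : forall z, unit_disc z -> C_derive f z <> RtoC 0).
{ apply (log_derivative_neq0 (C_derive f) (C_derive (C_derive f)) alpha); [lra| | |].
  - intros z Hz; apply analytic_at_diff, analytic_at_derive_near, Hf, Hz.
  - rewrite (proj2 (proj2 Hf)); intros E; injection E; lra.
  - intros z Hz; apply (Carg_bound _ _ (Harg z Hz)). }
assert (Hlt : forall z, unit_disc z -> z <> RtoC 0 -> Cmod (zder_minus f z) < Cmod (zder_plus f z)).
{ intros z Hz Hz0.
  destruct (Rlt_le_dec (Cmod (zder_minus f z)) (Cmod (zder_plus f z))) as [H|Hbad]; [exact H|exfalso].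
  destruct (first_touching_point f z Hf Hz Hz0 Hbad) as [w [Hw [Hw0 [Ht [Hin Hon]]]]].
  destruct (touching_conditions f w Hf Hf' Hw Hw0 Ht Hin Hon) as [b [Hre Him]].
  destruct (Carg_bound _ _ (Harg w Hw)) as [_ Hb].
  set (Q := (w * C_derive (C_derive f) w / C_derive f w)%C) in *.
  assert (Hs : sqrt 3 * sqrt 3 = 3) by (apply sqrt_sqrt; lra).
  pose proof (sqrt_pos 3) as Hs0.
  destruct Q as [q1 q2]; simpl in *.
  (* For b = 0 the second condition would read 0 <= -3/2. *)
  assert (Hb0 : b <> 0) by (intros ->; lra).
  assert (Hq1 : 1 + q1 = 0) by (apply Rmult_integral in Hre; tauto).
  replace (alpha + q1) with (alpha - 1) in Hb by lra.
  replace (sqrt 3 / (alpha - 1) * (alpha - 1)) with (sqrt 3) in Hb by (field; lra).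
  rewrite Rplus_0_l in *.
  (* AM-GM: (3 + b^2) / 2 >= sqrt 3 |b| *)
  pose proof (Rle_0_sqr (Rabs b - sqrt 3)) as Hsq; unfold Rsqr in Hsq.
  assert (Hbb : Rabs b * Rabs b = b * b) by (rewrite <- Rabs_mult, Rabs_pos_eq; nra).
  assert (Hprod : Rabs b * Rabs q2 < Rabs b * sqrt 3).
  { apply Rmult_lt_compat_l; [apply Rabs_pos_lt, Hb0|exact Hb]. }
  rewrite <- Rabs_mult in Hprod.
  pose proof (Rle_abs (- (b * q2))) as Hneg; rewrite Rabs_Ropp in Hneg; nra. }
split; [exact Hf|]; intros z Hz.
unfold starlike_quotient; destruct (Ceq_dec z (RtoC 0)) as [E|E].
{ split; [contradiction|simpl; lra]. }
specialize (Hlt z Hz E).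
(* At a zero of [f] both moduli equal |z f'|, against the strict inequality. *)
assert (Hfz : f z <> RtoC 0).
{ intros E0; revert Hlt; unfold zder_minus, zder_plus; rewrite E0.
  replace (z * C_derive f z - 0)%C with (z * C_derive f z + 0)%C by ring; lra. }
split; [intros _; exact Hfz|].
pose proof (Cmod_sqr_zder f z) as Hq; pose proof (Cmod_ge_0 (zder_minus f z)).
assert (Hdot : 0 < re_dot (f z) (z * C_derive f z)%C) by nra.
assert (Hm : 0 < Re (f z) ^ 2 + Im (f z) ^ 2).
{ rewrite <- Cmod2_alt; apply pow_lt, Cmod_gt_0, Hfz. }
replace (Re (z * C_derive f z / f z)%C)
  with (re_dot (f z) (z * C_derive f z)%C / (Re (f z) ^ 2 + Im (f z) ^ 2)).
- apply Rdiv_lt_0_compat; assumption.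
- clear - Hm; unfold re_dot; destruct (z * C_derive f z)%C, (f z); simpl in *; field; nra.
Qed.
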